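(* Let $a,b\in\mathbb{N}$, $\mathfrak{g}=\mathfrak{g}(A)$ with $A=\begin{bmatrix}-b&-a\\-a&-b\end{bmatrix}$, $\lambda\in P^{\pm}$, and $M_i=\frac{2}{A_{ii}}\lambda(\alpha_i^\vee)+1\in\mathbb{N}$ ($i=1,2$). Consider solutions $(X,Y)\in\mathbb{Z}_{\ge0}^2$ of $$(\ast)\qquad X^2+Y^2-M_1X-M_2Y+\tfrac{2a}{b}XY=0 .$$ (a) If $(X,Y)=\big(M_1,\ n=M_2-\frac{2a}{b}M_1\big)$ with $n\in\mathbb{Z}_{\ge0}$ is a solution of $(\ast)$, then the nonzero vectors of $f_2^{\,n}f_1^{\,M_1}M(\lambda)_\lambda$ are maximal. (b) If $(X,Y)=(1,n)$ or $(X,Y)=(n,1)$ is a solution of $(\ast)$, then $M(\lambda)_{\lambda-X\alpha_1-Y\alpha_2}$ has a unique maximal vector up to scalars. (c) If $(X,Y)=(2,2)$ is a solution of $(\ast)$, then the space of maximal vectors in $M(\lambda)_{\lambda-X\alpha_1-Y\alpha_2}$ has $2$ linearly independent elements, and its dimension is exactly $2$. In (b) and (c) these counts, i.e. $\dim\mathrm{Hom}_{\mathfrak{g}}\big(M(\lambda-X\alpha_1-Y\alpha_2),M(\lambda)\big)$, equal respectively $\dim\mathfrak{g}_{X\alpha_1+Y\alpha_2}=1$ (e.g. $\dim\mathfrak{g}_{\alpha_1+n\alpha_2}=1$ for $(1,n)$) and $\dim\mathfrak{g}_{\alpha_1+\alpha_2}+\dim\mathfrak{g}_{2\alpha_1+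2\alpha_2}=2$.
   Context: $\mathbb{N}$ denotes positive integers. The Borcherds--Kac--Moody Lie algebra $\mathfrak{g}(A)$ over $\mathbb{C}$ for $\mathcal{I}=\{1,2\}$ and $A$ as in the claim has Cartan subalgebra $\mathfrak{h}$ ($\dim\mathfrak{h}=2+\text{nullity}(A)$), linearly independent simple roots $\alpha_i\in\mathfrak{h}^*$ and simple co-roots $\alpha_i^\vee\in\mathfrak{h}$ with $\alpha_j(\alpha_i^\vee)=A_{ij}$, and is generated by $\mathfrak{h},e_i,f_i$ with $[\mathfrak{h},\mathfrak{h}]=0$, $[h,e_i]=\alpha_i(h)e_i$, $[h,f_i]=-\alpha_i(h)f_i$, $[e_i,f_j]=\delta_{ij}\alpha_i^\vee$. $\mathfrak{g}_\alpha$ denotes the root space and $\mathfrak{n}^+$ the subalgebra generated by $e_1,e_2$. $P^{\pm}=\{\lambda\in\mathfrak{h}^*:\lambda(\alpha_i^\vee)\in\frac{A_{ii}}{2}\mathbb{Z}_{\ge0}\ \forall i\}$. $M(\lambda)$ is the Verma module of highest weight $\lambda$, $M(\lambda)_\mu$ its $\mu$-weight space. A maximal vector is a nonzero weight vector killed by $\mathfrak{n}^+$. *)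

(* Defs.v *)
From HB Require Import structures.
From mathcomp Require Import all_boot all_order all_algebra.
From mathcomp Require Import generic_quotient.
From mathcomp Require Import boolp reals complex.

Set Implicit Arguments.
Unset Strict Implicit.
Unset Printing Implicit Defensive.

Import Order.TTheory GRing.Theory Num.Theory.
Local Open Scope ring_scope.
Local Open Scope quotient_scope.

HB.mixin Record Lmodule_isLieAlgebra (K : fieldType) L
    of GRing.Lmodule K L := {
  lie : L -> L -> L;
  lieDl : forall x y z, lie (x + y) z = lie x z + lie y z;
  lieZl : forall (c : K) x y, lie (c *: x) y = c *: lie x y;
  lieDr : forall x y z, lie x (y + z) = lie x y + lie x z;
  lieZr : forall (c : K) x y, lie x (c *: y) = c *: lie x y;
  liexx : forall x, lie x x = 0;
  lie_jacobi : forall x y z,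
    lie x (lie y z) + lie y (lie z x) + lie z (lie x y) = 0
}.

#[short(type="lieAlgType")]
HB.structure Definition LieAlgebra (K : fieldType) :=
  { L of GRing.Lmodule K L & Lmodule_isLieAlgebra K L }.

HB.mixin Record Lmodule_isLieModule (K : fieldType) (L : lieAlgType K) V
    of GRing.Lmodule K V := {
  lact : L -> V -> V;
  lactDl : forall x y v, lact (x + y) v = lact x v + lact y v;
  lactZl : forall (c : K) x v, lact (c *: x) v = c *: lact x v;
  lactDr : forall x v w, lact x (v + w) = lact x v + lact x w;
  lactZr : forall (c : K) x v, lact x (c *: v) = c *: lact x v;
  lact_lie : forall x y v,
    lact (lie x y) v = lact x (lact y v) - lact y (lact x v)
}.

#[short(type="lieModType")]
HB.structure Definition LieModule (K : fieldType) (L : lieAlgType K) :=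
  { V of GRing.Lmodule K V & Lmodule_isLieModule K L V }.

Arguments lact {K L s} _ _.

Section Dimension.
Variables (K : fieldType) (V : lmodType K).

Definition lin_indep d (v : 'I_d -> V) : Prop :=
  forall c : 'I_d -> K, \sum_i c i *: v i = 0 -> forall i, c i = 0.

(* [P] is meant to be a linear subspace, possibly of an infinite-dimensional
   [V]; this is why [{vspace _}] and [\dim] are not used. *)
Definition has_dim (P : V -> Prop) (d : nat) : Prop :=
  exists v : 'I_d -> V,
    [/\ forall i, P (v i), lin_indep v
      & forall w, P w -> exists c : 'I_d -> K, w = \sum_i c i *: v i].

End Dimension.

Section LieModuleHom.
Variables (K : fieldType) (L : lieAlgType K) (V W : lieModType L).

Definition lie_module_hom (f : V -> W) : Prop :=
  (forall (c : K) u v, f (c *: u + v) = c *: f u + f v)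
  /\ (forall x v, f (lact x v) = lact x (f v)).

(* [\dim Hom_L(V, W) = d], the functions [V -> W] being added and scaled
   pointwise. *)
Definition hom_has_dim (d : nat) : Prop :=
  exists f : 'I_d -> V -> W,
    [/\ forall i, lie_module_hom (f i),
        forall c : 'I_d -> K,
          (forall v, \sum_i c i *: f i v = 0) -> forall i, c i = 0
      & forall g, lie_module_hom g ->
          exists c : 'I_d -> K, forall v, g v = \sum_i c i *: f i v].

End LieModuleHom.

(* Operations on a type [lp_car] of formal expressions, together with a
   congruence modulo which they form a [K]-module. *)
Record lin_presentation (K : fieldType) := LinPresentation {
  lp_car :> Type;
  lp_0 : lp_car;
  lp_add : lp_car -> lp_car -> lp_car;
  lp_opp : lp_car -> lp_car;
  lp_scale : K -> lp_car -> lp_car;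
  lp_eq : lp_car -> lp_car -> Prop;
  lp_refl : forall x, lp_eq x x;
  lp_sym : forall x y, lp_eq x y -> lp_eq y x;
  lp_trans : forall x y z, lp_eq x y -> lp_eq y z -> lp_eq x z;
  lp_congD : forall x x' y y', lp_eq x x' -> lp_eq y y' ->
    lp_eq (lp_add x y) (lp_add x' y');
  lp_congN : forall x x', lp_eq x x' -> lp_eq (lp_opp x) (lp_opp x');
  lp_congZ : forall c x x', lp_eq x x' -> lp_eq (lp_scale c x) (lp_scale c x');
  lp_addA : forall x y z,
    lp_eq (lp_add x (lp_add y z)) (lp_add (lp_add x y) z);
  lp_addC : forall x y, lp_eq (lp_add x y) (lp_add y x);
  lp_add0 : forall x, lp_eq (lp_add lp_0 x) x;
  lp_addN : forall x, lp_eq (lp_add (lp_opp x) x) lp_0;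
  lp_scaleA : forall c d x,
    lp_eq (lp_scale c (lp_scale d x)) (lp_scale (c * d) x);
  lp_scale1 : forall x, lp_eq (lp_scale 1 x) x;
  lp_scaleDr : forall c x y,
    lp_eq (lp_scale c (lp_add x y)) (lp_add (lp_scale c x) (lp_scale c y));
  lp_scaleDl : forall x c d,
    lp_eq (lp_scale (c + d) x) (lp_add (lp_scale c x) (lp_scale d x))
}.

Section LinQuotient.
Variables (K : fieldType) (P : lin_presentation K).

Definition lp_rel (x y : {classic P}) : bool := `[< lp_eq x y >].

Lemma lp_relP : equiv_class_of lp_rel.
Proof.
split.
- by move=> x; apply/asboolP; exact: lp_refl.
- by move=> x y; apply/asboolP/asboolP; exact: lp_sym.
- move=> y x z /asboolP xy /asboolP yz; apply/asboolP; exact: lp_trans xy yz.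
Qed.

Canonical lp_equiv := EquivRelPack lp_relP.

Definition lin_quot := {eq_quot lp_equiv}.
HB.instance Definition _ := Choice.on lin_quot.
HB.instance Definition _ := EqQuotient.on lin_quot.

Definition lq_pi (x : P) : lin_quot := \pi_lin_quot (x : {classic P}).

Lemma lq_piP x y : lq_pi x = lq_pi y <-> lp_eq x y.
Proof.
split; first by move=> /eqquotP /asboolP.
by move=> xy; apply/eqquotP/asboolP.
Qed.

Lemma lq_reprP (x : P) : lp_eq (repr (lq_pi x)) x.
Proof. by apply/lq_piP; rewrite /lq_pi reprK. Qed.

Lemma lq_surj (x : lin_quot) : lq_pi (repr x) = x.
Proof. by rewrite /lq_pi reprK. Qed.

Definition lq_add (x y : lin_quot) := lq_pi (lp_add (repr x) (repr y)).
Definition lq_opp (x : lin_quot) := lq_pi (lp_opp (repr x)).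
Definition lq_scale c (x : lin_quot) := lq_pi (lp_scale c (repr x)).

Lemma lq_addE x y : lq_add (lq_pi x) (lq_pi y) = lq_pi (lp_add x y).
Proof. by apply/lq_piP; apply: lp_congD; exact: lq_reprP. Qed.

Lemma lq_oppE x : lq_opp (lq_pi x) = lq_pi (lp_opp x).
Proof. by apply/lq_piP; apply: lp_congN; exact: lq_reprP. Qed.

Lemma lq_scaleE c x : lq_scale c (lq_pi x) = lq_pi (lp_scale c x).
Proof. by apply/lq_piP; apply: lp_congZ; exact: lq_reprP. Qed.

Let lq_addA : associative lq_add.
Proof.
move=> x y z; rewrite -(lq_surj x) -(lq_surj y) -(lq_surj z) !lq_addE.
by apply/lq_piP; exact: lp_addA.
Qed.

Let lq_addC : commutative lq_add.
Proof.
move=> x y; rewrite -(lq_surj x) -(lq_surj y) !lq_addE.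
by apply/lq_piP; exact: lp_addC.
Qed.

Let lq_add0 : left_id (lq_pi (lp_0 P)) lq_add.
Proof.
by move=> x; rewrite -(lq_surj x) lq_addE; apply/lq_piP; exact: lp_add0.
Qed.

Let lq_addN : left_inverse (lq_pi (lp_0 P)) lq_opp lq_add.
Proof.
move=> x; rewrite -(lq_surj x) lq_oppE lq_addE.
by apply/lq_piP; exact: lp_addN.
Qed.

HB.instance Definition _ :=
  GRing.isZmodule.Build lin_quot lq_addA lq_addC lq_add0 lq_addN.

Let lq_scaleA c d x : lq_scale c (lq_scale d x) = lq_scale (c * d) x.
Proof.
rewrite -(lq_surj x) !lq_scaleE; apply/lq_piP; exact: lp_scaleA.
Qed.

Let lq_scale1 : left_id 1 lq_scale.
Proof.
by move=> x; rewrite -(lq_surj x) lq_scaleE; apply/lq_piP; exact: lp_scale1.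
Qed.

Let lq_scaleDr : right_distributive lq_scale +%R.
Proof.
move=> c x y; rewrite -(lq_surj x) -(lq_surj y) [_ + _]lq_addE !lq_scaleE.
rewrite [RHS]lq_addE; apply/lq_piP; exact: lp_scaleDr.
Qed.

Let lq_scaleDl x : {morph lq_scale^~ x : c d / c + d}.
Proof.
move=> c d; rewrite -(lq_surj x) !lq_scaleE [RHS]lq_addE.
apply/lq_piP; exact: lp_scaleDl.
Qed.

HB.instance Definition _ := GRing.Zmodule_isLmodule.Build K lin_quot
  lq_scaleA lq_scale1 lq_scaleDr lq_scaleDl.

Lemma lq_pi0 : lq_pi (lp_0 P) = 0.
Proof. by []. Qed.

Lemma lq_piD x y : lq_pi (lp_add x y) = lq_pi x + lq_pi y.
Proof. by rewrite -lq_addE. Qed.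

Lemma lq_piN x : lq_pi (lp_opp x) = - lq_pi x.
Proof. by rewrite -lq_oppE. Qed.

Lemma lq_piZ c x : lq_pi (lp_scale c x) = c *: lq_pi x.
Proof. by rewrite -lq_scaleE. Qed.

End LinQuotient.

(* [n - \rank A] is the nullity of [A]. *)
Record realization (K : fieldType) (n : nat) (A : 'M[K]_n) := Realization {
  cartan : vectType K;
  simple_root : 'I_n -> 'Hom(cartan, K^o);
  simple_coroot : 'I_n -> cartan;
  simple_root_free : free [tuple simple_root i | i < n];
  simple_coroot_free : free [tuple simple_coroot i | i < n];
  simple_root_coroot : forall i j, simple_root j (simple_coroot i) = A i j;
  dim_cartan : \dim {:cartan} = (n + (n - \rank A))%N
}.

Section BKM.
Variables (K : numFieldType) (n : nat) (A : 'M[K]_n) (H : realization A).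

Inductive bkm_term : Type :=
| TE of 'I_n
| TF of 'I_n
| TH of cartan H
| T0
| Tadd of bkm_term & bkm_term
| Topp of bkm_term
| Tscale of K & bkm_term
| Tlie of bkm_term & bkm_term.

(* The last four clauses are the Serre relations of a general
   Borcherds--Kac--Moody matrix; they are void when [A i i < 0] for all [i]
   and [A i j != 0] for all [i, j]. *)
Inductive bkm_eq : bkm_term -> bkm_term -> Prop :=
| bkm_refl x : bkm_eq x x
| bkm_sym x y : bkm_eq x y -> bkm_eq y x
| bkm_trans x y z : bkm_eq x y -> bkm_eq y z -> bkm_eq x z
| bkm_congD x x' y y' : bkm_eq x x' -> bkm_eq y y' ->
    bkm_eq (Tadd x y) (Tadd x' y')
| bkm_congN x x' : bkm_eq x x' -> bkm_eq (Topp x) (Topp x')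
| bkm_congZ c x x' : bkm_eq x x' -> bkm_eq (Tscale c x) (Tscale c x')
| bkm_congL x x' y y' : bkm_eq x x' -> bkm_eq y y' ->
    bkm_eq (Tlie x y) (Tlie x' y')
| bkm_addA x y z : bkm_eq (Tadd x (Tadd y z)) (Tadd (Tadd x y) z)
| bkm_addC x y : bkm_eq (Tadd x y) (Tadd y x)
| bkm_add0 x : bkm_eq (Tadd T0 x) x
| bkm_addN x : bkm_eq (Tadd (Topp x) x) T0
| bkm_scaleA c d x : bkm_eq (Tscale c (Tscale d x)) (Tscale (c * d) x)
| bkm_scale1 x : bkm_eq (Tscale 1 x) x
| bkm_scaleDr c x y :
    bkm_eq (Tscale c (Tadd x y)) (Tadd (Tscale c x) (Tscale c y))
| bkm_scaleDl x c d :
    bkm_eq (Tscale (c + d) x) (Tadd (Tscale c x) (Tscale d x))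
| bkm_lieDl x y z :
    bkm_eq (Tlie (Tadd x y) z) (Tadd (Tlie x z) (Tlie y z))
| bkm_lieZl c x y : bkm_eq (Tlie (Tscale c x) y) (Tscale c (Tlie x y))
| bkm_lieDr x y z :
    bkm_eq (Tlie x (Tadd y z)) (Tadd (Tlie x y) (Tlie x z))
| bkm_lieZr c x y : bkm_eq (Tlie x (Tscale c y)) (Tscale c (Tlie x y))
| bkm_liexx x : bkm_eq (Tlie x x) T0
| bkm_jacobi x y z :
    bkm_eq (Tadd (Tadd (Tlie x (Tlie y z)) (Tlie y (Tlie z x)))
                 (Tlie z (Tlie x y))) T0
| bkm_HD h h' : bkm_eq (TH (h + h')) (Tadd (TH h) (TH h'))
| bkm_HZ c h : bkm_eq (TH (c *: h)) (Tscale c (TH h))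
| bkm_HH h h' : bkm_eq (Tlie (TH h) (TH h')) T0
| bkm_HE h i : bkm_eq (Tlie (TH h) (TE i)) (Tscale (simple_root H i h) (TE i))
| bkm_HF h i : bkm_eq (Tlie (TH h) (TF i)) (Tscale (- simple_root H i h) (TF i))
| bkm_EF i : bkm_eq (Tlie (TE i) (TF i)) (TH (simple_coroot H i))
| bkm_EF0 i j : i != j -> bkm_eq (Tlie (TE i) (TF j)) T0
| bkm_serreE i j (m : nat) : i != j -> 0 < A i i ->
    m%:R = 1 - 2 * A i j / A i i -> bkm_eq (iter m (Tlie (TE i)) (TE j)) T0
| bkm_serreF i j (m : nat) : i != j -> 0 < A i i ->
    m%:R = 1 - 2 * A i j / A i i -> bkm_eq (iter m (Tlie (TF i)) (TF j)) T0
| bkm_commE i j : A i j = 0 -> bkm_eq (Tlie (TE i) (TE j)) T0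
| bkm_commF i j : A i j = 0 -> bkm_eq (Tlie (TF i) (TF j)) T0.

Definition bkm_presentation : lin_presentation K :=
  LinPresentation bkm_refl bkm_sym bkm_trans bkm_congD bkm_congN bkm_congZ
    bkm_addA bkm_addC bkm_add0 bkm_addN bkm_scaleA bkm_scale1 bkm_scaleDr
    bkm_scaleDl.

Definition bkm := lin_quot bkm_presentation.
HB.instance Definition _ := GRing.Lmodule.on bkm.

Definition bkm_pi (x : bkm_term) : bkm := @lq_pi K bkm_presentation x.

Lemma bkm_piP x y : bkm_pi x = bkm_pi y <-> bkm_eq x y.
Proof. exact: lq_piP. Qed.

Definition bkm_lie (x y : bkm) : bkm := bkm_pi (Tlie (repr x) (repr y)).

Lemma bkm_lieE x y : bkm_lie (bkm_pi x) (bkm_pi y) = bkm_pi (Tlie x y).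
Proof.
by apply/bkm_piP; apply: bkm_congL; exact: (@lq_reprP K bkm_presentation).
Qed.

Lemma bkm_surj (x : bkm) : bkm_pi (repr x) = x.
Proof. exact: lq_surj. Qed.

Lemma bkm_pi0 : bkm_pi T0 = 0.
Proof. exact: lq_pi0. Qed.

Lemma bkm_piD x y : bkm_pi (Tadd x y) = bkm_pi x + bkm_pi y.
Proof. exact: lq_piD. Qed.

Lemma bkm_piN x : bkm_pi (Topp x) = - bkm_pi x.
Proof. exact: lq_piN. Qed.

Lemma bkm_piZ c x : bkm_pi (Tscale c x) = c *: bkm_pi x.
Proof. exact: lq_piZ. Qed.

Let lieDl x y z : bkm_lie (x + y) z = bkm_lie x z + bkm_lie y z.
Proof.
rewrite -(bkm_surj x) -(bkm_surj y) -(bkm_surj z) -bkm_piD !bkm_lieE -bkm_piD.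
by apply/bkm_piP; exact: bkm_lieDl.
Qed.

Let lieZl (c : K) x y : bkm_lie (c *: x) y = c *: bkm_lie x y.
Proof.
rewrite -(bkm_surj x) -(bkm_surj y) -bkm_piZ !bkm_lieE -bkm_piZ.
by apply/bkm_piP; exact: bkm_lieZl.
Qed.

Let lieDr x y z : bkm_lie x (y + z) = bkm_lie x y + bkm_lie x z.
Proof.
rewrite -(bkm_surj x) -(bkm_surj y) -(bkm_surj z) -bkm_piD !bkm_lieE -bkm_piD.
by apply/bkm_piP; exact: bkm_lieDr.
Qed.

Let lieZr (c : K) x y : bkm_lie x (c *: y) = c *: bkm_lie x y.
Proof.
rewrite -(bkm_surj x) -(bkm_surj y) -bkm_piZ !bkm_lieE -bkm_piZ.
by apply/bkm_piP; exact: bkm_lieZr.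
Qed.

Let liexx x : bkm_lie x x = 0.
Proof.
rewrite -(bkm_surj x) bkm_lieE -bkm_pi0.
by apply/bkm_piP; exact: bkm_liexx.
Qed.

Let jacobi x y z : bkm_lie x (bkm_lie y z) + bkm_lie y (bkm_lie z x)
  + bkm_lie z (bkm_lie x y) = 0.
Proof.
rewrite -(bkm_surj x) -(bkm_surj y) -(bkm_surj z) !bkm_lieE -!bkm_piD -bkm_pi0.
by apply/bkm_piP; exact: bkm_jacobi.
Qed.

HB.instance Definition _ := Lmodule_isLieAlgebra.Build K bkm
  lieDl lieZl lieDr lieZr liexx jacobi.

Definition bkm_e (i : 'I_n) : bkm := bkm_pi (TE i).
Definition bkm_f (i : 'I_n) : bkm := bkm_pi (TF i).
Definition bkm_h (h : cartan H) : bkm := bkm_pi (TH h).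

Definition root_space (mu : 'Hom(cartan H, K^o)) (x : bkm) : Prop :=
  forall h, lie (bkm_h h) x = (mu h : K) *: x.

(* The Lie subalgebra generated by the [bkm_e i]. *)
Inductive nplus : bkm -> Prop :=
| nplus_e i : nplus (bkm_e i)
| nplus0 : nplus 0
| nplusD x y : nplus x -> nplus y -> nplus (x + y)
| nplusZ (c : K) x : nplus x -> nplus (c *: x)
| nplus_lie x y : nplus x -> nplus y -> nplus (lie x y).

Section Weights.
Variable V : lieModType bkm.

Definition weight_space (mu : 'Hom(cartan H, K^o)) (v : V) : Prop :=
  forall h, lact (bkm_h h) v = (mu h : K) *: v.

Definition killed_by_nplus (v : V) : Prop :=
  forall x, nplus x -> lact x v = 0.

Definition maximal_vector (v : V) : Prop :=
  [/\ v != 0, exists mu, weight_space mu v & killed_by_nplus v].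

(* The maximal vectors of weight [mu] together with [0]. *)
Definition maximal_space (mu : 'Hom(cartan H, K^o)) (v : V) : Prop :=
  weight_space mu v /\ killed_by_nplus v.

End Weights.

Definition Ppm (lam : 'Hom(cartan H, K^o)) : Prop :=
  forall i, exists k : nat, lam (simple_coroot H i) = A i i / 2 * k%:R.

End BKM.

Section Verma.
Variables (K : numFieldType) (n : nat) (A : 'M[K]_n) (H : realization A).
Variable lam : 'Hom(cartan H, K^o).

Inductive verma_term : Type :=
| Vhw
| V0
| Vadd of verma_term & verma_term
| Vopp of verma_term
| Vscale of K & verma_term
| Vact of bkm H & verma_term.

(* The module generated by [Vhw] with the relations [n^+ Vhw = 0] and
   [h Vhw = lam h Vhw], that is, the quotient of the enveloping algebra by the
   left ideal generated by [n^+] and the [h - lam h]. *)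
Inductive verma_eq : verma_term -> verma_term -> Prop :=
| verma_refl v : verma_eq v v
| verma_sym v w : verma_eq v w -> verma_eq w v
| verma_trans u v w : verma_eq u v -> verma_eq v w -> verma_eq u w
| verma_congD v v' w w' : verma_eq v v' -> verma_eq w w' ->
    verma_eq (Vadd v w) (Vadd v' w')
| verma_congN v v' : verma_eq v v' -> verma_eq (Vopp v) (Vopp v')
| verma_congZ c v v' : verma_eq v v' -> verma_eq (Vscale c v) (Vscale c v')
| verma_congA x v v' : verma_eq v v' -> verma_eq (Vact x v) (Vact x v')
| verma_addA u v w : verma_eq (Vadd u (Vadd v w)) (Vadd (Vadd u v) w)
| verma_addC v w : verma_eq (Vadd v w) (Vadd w v)
| verma_add0 v : verma_eq (Vadd V0 v) v
| verma_addN v : verma_eq (Vadd (Vopp v) v) V0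
| verma_scaleA c d v : verma_eq (Vscale c (Vscale d v)) (Vscale (c * d) v)
| verma_scale1 v : verma_eq (Vscale 1 v) v
| verma_scaleDr c v w :
    verma_eq (Vscale c (Vadd v w)) (Vadd (Vscale c v) (Vscale c w))
| verma_scaleDl v c d :
    verma_eq (Vscale (c + d) v) (Vadd (Vscale c v) (Vscale d v))
| verma_actDl x y v :
    verma_eq (Vact (x + y) v) (Vadd (Vact x v) (Vact y v))
| verma_actZl c x v : verma_eq (Vact (c *: x) v) (Vscale c (Vact x v))
| verma_actDr x v w :
    verma_eq (Vact x (Vadd v w)) (Vadd (Vact x v) (Vact x w))
| verma_actZr c x v : verma_eq (Vact x (Vscale c v)) (Vscale c (Vact x v))
| verma_act_lie x y v : verma_eq (Vact (lie x y) v)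
    (Vadd (Vact x (Vact y v)) (Vopp (Vact y (Vact x v))))
| verma_nplus x : nplus x -> verma_eq (Vact x Vhw) V0
| verma_cartan h : verma_eq (Vact (bkm_h h) Vhw) (Vscale (lam h) Vhw).

Definition verma_presentation : lin_presentation K :=
  LinPresentation verma_refl verma_sym verma_trans verma_congD verma_congN
    verma_congZ verma_addA verma_addC verma_add0 verma_addN verma_scaleA
    verma_scale1 verma_scaleDr verma_scaleDl.

Definition verma := lin_quot verma_presentation.
HB.instance Definition _ := GRing.Lmodule.on verma.

Definition verma_pi (v : verma_term) : verma := @lq_pi K verma_presentation v.

Lemma verma_piP v w : verma_pi v = verma_pi w <-> verma_eq v w.
Proof. exact: lq_piP. Qed.

Lemma verma_surj (v : verma) : verma_pi (repr v) = v.
Proof. exact: lq_surj. Qed.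

Lemma verma_pi0 : verma_pi V0 = 0.
Proof. exact: lq_pi0. Qed.

Lemma verma_piD v w : verma_pi (Vadd v w) = verma_pi v + verma_pi w.
Proof. exact: lq_piD. Qed.

Lemma verma_piN v : verma_pi (Vopp v) = - verma_pi v.
Proof. exact: lq_piN. Qed.

Lemma verma_piZ c v : verma_pi (Vscale c v) = c *: verma_pi v.
Proof. exact: lq_piZ. Qed.

Definition verma_act (x : bkm H) (v : verma) : verma :=
  verma_pi (Vact x (repr v)).

Lemma verma_actE x v : verma_act x (verma_pi v) = verma_pi (Vact x v).
Proof.
by apply/verma_piP; apply: verma_congA;
  exact: (@lq_reprP K verma_presentation).
Qed.

Let actDl x y v : verma_act (x + y) v = verma_act x v + verma_act y v.
Proof.
rewrite -(verma_surj v) !verma_actE -verma_piD.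
by apply/verma_piP; exact: verma_actDl.
Qed.

Let actZl (c : K) x v : verma_act (c *: x) v = c *: verma_act x v.
Proof.
rewrite -(verma_surj v) !verma_actE -verma_piZ.
by apply/verma_piP; exact: verma_actZl.
Qed.

Let actDr x v w : verma_act x (v + w) = verma_act x v + verma_act x w.
Proof.
rewrite -(verma_surj v) -(verma_surj w) -verma_piD !verma_actE -verma_piD.
by apply/verma_piP; exact: verma_actDr.
Qed.

Let actZr (c : K) x v : verma_act x (c *: v) = c *: verma_act x v.
Proof.
rewrite -(verma_surj v) -verma_piZ !verma_actE -verma_piZ.
by apply/verma_piP; exact: verma_actZr.
Qed.

Let act_lie x y v : verma_act (lie x y) v
  = verma_act x (verma_act y v) - verma_act y (verma_act x v).
Proof.
rewrite -(verma_surj v) !verma_actE -verma_piN -verma_piD.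
by apply/verma_piP; exact: verma_act_lie.
Qed.

HB.instance Definition _ := Lmodule_isLieModule.Build K (bkm H) verma
  actDl actZl actDr actZr act_lie.

Definition verma_hw : verma := verma_pi Vhw.

End Verma.

Definition bkm_matrix (R : realType) (a b : nat) : 'M[R[i]]_2 :=
  \matrix_(i, j) (if i == j then - b%:R else - a%:R).

Definition star (a b M1 M2 X Y : nat) : Prop :=
  X%:R ^+ 2 + Y%:R ^+ 2 - M1%:R * X%:R - M2%:R * Y%:R
    + 2 * a%:R / b%:R * X%:R * Y%:R = 0 :> rat.

(* Main.v *)
(** Since [A] has negative diagonal and no zero entry, no Serre relations occur,
    so [n^-] is free and a Verma module has the words in [f_1, f_2] as a basis.
    Freeness is obtained by letting [bkm H] act on the functions on words (a
    completed Verma module); the coordinates of a vector are its image there,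
    and maximal vectors become the solutions of a finite linear system.

    In weight [lam - alpha_p - n alpha_q] the equations for [e_q] form a
    two-term recurrence, and [star] makes the equation for [e_p] a telescoping
    sum of them.  In weight [lam - 2 alpha_1 - 2 alpha_2] the six equations
    force the coordinates at [f_1 f_2 f_2 f_1] and [f_2 f_1 f_1 f_2] to agree,
    after which three independent equations in five unknowns remain.

    A root space is spanned by right-normed brackets of the [e_i]; these are
    seen to be nonzero in the word module twisted by the Chevalley involution. *)

Require Import Defs.
From HB Require Import structures.
From mathcomp Require Import all_boot all_order all_algebra.
From mathcomp Require Import ring zify.
From mathcomp Require Import boolp functions reals complex.

Set Implicit Arguments.
Unset Strict Implicit.
Unset Printing Implicit Defensive.

Import Order.TTheory GRing.Theory Num.Theory.
Local Open Scope ring_scope.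

(** [bkm H] and [verma lam] are quotients of formal expressions: the relations only produce
    equalities, so that showing something nonzero or independent needs a concrete module to map to.
    The word module serves twice. Its [f_i] prepend letters, which makes the image of [verma lam]
    free over words; after the twist it is the [e_i] that prepend letters, as positive root spaces
    require.

    Part (a) is the sl_2 computation of [e_i f_i^m v] with [A i i] in place of 2: M_1 is the
    exponent at which the scalar vanishes on weight [lam], and n is the corresponding exponent of
    f_2 on weight [lam - M_1 alpha_1].

    In (b) a two-term recurrence could still have too many or too few solutions where coefficients
    vanish. The norm equation rules this out: one of the two coefficient sequences has no zero in
    the range, which one depending on whether M_p = 1. In (c) the degenerate case is M_1 = M_2 = 2,
    where the rank would drop; a > 0 excludes it. *)

Section LieTheory.
Variables (K : fieldType) (L : lieAlgType K).
Implicit Types x y z : L.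

Lemma lie0l x : lie 0 x = 0.
Proof. by have := lieZl 0 0 x; rewrite !scale0r. Qed.

Lemma lie0r x : lie x 0 = 0.
Proof. by have := lieZr 0 x 0; rewrite !scale0r. Qed.

Lemma lieC x y : lie x y = - lie y x.
Proof.
apply/eqP; rewrite -addr_eq0 -(liexx (x + y)) lieDl !lieDr !liexx.
by rewrite add0r addr0.
Qed.

Lemma lieNr x y : lie x (- y) = - lie x y.
Proof. by rewrite -scaleN1r lieZr scaleN1r. Qed.

Lemma lie_leibniz x y z : lie x (lie y z) = lie (lie x y) z + lie y (lie x z).
Proof.
apply/eqP; rewrite (lieC (lie x y)) -subr_eq0 opprD opprK addrA addrAC.
by rewrite -lieNr -lieC lie_jacobi.
Qed.

End LieTheory.

Section LieModuleTheory.
Variables (K : fieldType) (L : lieAlgType K) (V : lieModType L).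
Implicit Types (x : L) (v : V).

Lemma lact0l v : lact 0 v = 0.
Proof. by have := lactZl 0 0 v; rewrite !scale0r. Qed.

Lemma lact0r x : lact x (0 : V) = 0.
Proof. by have := lactZr 0 x (0 : V); rewrite !scale0r. Qed.

Lemma lact_sum x (I : Type) (r : seq I) (F : I -> V) :
  lact x (\sum_(i <- r) F i) = \sum_(i <- r) lact x (F i).
Proof.
elim: r => [|i r IHr]; first by rewrite !big_nil lact0r.
by rewrite !big_cons lactDr IHr.
Qed.

End LieModuleTheory.

Section LieModuleHomTheory.
Variables (K : fieldType) (L : lieAlgType K) (U V : lieModType L).
Variable f : U -> V.

Lemma lie_hom0 : lie_module_hom f -> f 0 = 0.
Proof.
move=> [flin _]; have := flin 1 0 0; rewrite !scale1r addr0.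
by rewrite -[LHS]addr0 => /addrI.
Qed.

Lemma lie_homD u v : lie_module_hom f -> f (u + v) = f u + f v.
Proof. by move=> [flin _]; have := flin 1 u v; rewrite !scale1r. Qed.

Lemma lie_homZ c u : lie_module_hom f -> f (c *: u) = c *: f u.
Proof. by move=> fh; have := fh.1 c u 0; rewrite (lie_hom0 fh) !addr0. Qed.

End LieModuleHomTheory.

Section Dim1.
Variables (K : fieldType) (V : lmodType K).

Lemma has_dim1 (P : V -> Prop) (v : V) : P v -> v != 0 ->
  (forall w, P w -> exists c : K, w = c *: v) -> has_dim P 1.
Proof.
move=> Pv v0 span; exists (fun=> v); split=> // [c|w /span[c ->]].
  rewrite big_ord1 => /eqP; rewrite scaler_eq0 (negPf v0) orbF => /eqP c0 i.
  by rewrite ord1.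
by exists (fun=> c); rewrite big_ord1.
Qed.

Lemma has_dim1_ex (P : V -> Prop) : has_dim P 1 ->
  exists v, [/\ P v, v != 0 & forall w, P w -> exists c : K, w = c *: v].
Proof.
move=> [v [Pv indep span]]; exists (v ord0); split=> // [|w /span[c ->]].
  apply/eqP => v0; have /(_ _ ord0)/eqP := indep (fun=> 1).
  by rewrite oner_eq0 big_ord1 v0 scaler0 => /(_ erefl).
by exists (c ord0); rewrite big_ord1.
Qed.

End Dim1.

(** * The relations of the algebra, and modules built from operators *)

Section BKMTheory.
Variables (K : numFieldType) (n : nat) (A : 'M[K]_n) (H : realization A).

Lemma bkm_ind (P : bkm H -> Prop) :
  (forall i, P (bkm_e H i)) -> (forall i, P (bkm_f H i)) ->
  (forall h, P (bkm_h h)) -> P 0 ->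
  (forall x y, P x -> P y -> P (x + y)) ->
  (forall (c : K) x, P x -> P (c *: x)) ->
  (forall x y, P x -> P y -> P (lie x y)) -> forall x, P x.
Proof.
move=> Pe Pf Ph P0 PD PZ PL x; rewrite -(bkm_surj x).
elim: (repr x) => {x} [i|i|h||x Px y Py|x Px|c x Px|x Px y Py].
- exact: Pe.
- exact: Pf.
- exact: Ph.
- by rewrite bkm_pi0.
- by rewrite bkm_piD; exact: PD.
- by rewrite bkm_piN -scaleN1r; exact: PZ.
- by rewrite bkm_piZ; exact: PZ.
- by rewrite -bkm_lieE; exact: PL.
Qed.

Lemma lie_he h i :
  lie (bkm_h h) (bkm_e H i) = (simple_root H i h : K) *: bkm_e H i.
Proof. by rewrite [LHS]bkm_lieE -bkm_piZ; apply/bkm_piP; exact: bkm_HE. Qed.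

Lemma lie_hf h i :
  lie (bkm_h h) (bkm_f H i) = - (simple_root H i h : K) *: bkm_f H i.
Proof. by rewrite [LHS]bkm_lieE -bkm_piZ; apply/bkm_piP; exact: bkm_HF. Qed.

Lemma lie_hh h h' : lie (bkm_h h) (bkm_h h') = 0 :> bkm H.
Proof. by rewrite [LHS]bkm_lieE -bkm_pi0; apply/bkm_piP; exact: bkm_HH. Qed.

Lemma lie_ef i j : lie (bkm_e H i) (bkm_f H j) =
  if i == j then bkm_h (simple_coroot H i) else 0.
Proof.
rewrite [LHS]bkm_lieE; have [<-|ij] := eqVneq; apply/bkm_piP.
  exact: bkm_EF.
exact: bkm_EF0.
Qed.

Lemma killed_by_nplusP (V : lieModType (bkm H)) (v : V) :
  killed_by_nplus v <-> forall i, lact (bkm_e H i) v = 0.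
Proof.
split=> [kv i|ev x]; first by apply: kv; exact: nplus_e.
elim=> {x} [//||x y _ xv _ yv|c x _ xv|x y _ xv _ yv].
- exact: lact0l.
- by rewrite lactDl xv yv addr0.
- by rewrite lactZl xv scaler0.
- by rewrite lact_lie xv yv !lact0r subr0.
Qed.

Lemma weight_space_f (V : lieModType (bkm H)) mu i (v : V) :
  weight_space mu v -> weight_space (mu - simple_root H i) (lact (bkm_f H i) v).
Proof.
move=> vmu h; have := lact_lie (bkm_h h) (bkm_f H i) v.
rewrite lie_hf lactZl vmu => /esym/eqP;
  rewrite subr_eq lactZr -scalerDl => /eqP ->.
by rewrite add_lfunE opp_lfunE [in LHS]addrC.
Qed.

(* Operators satisfying the defining relations of [bkm H], apart from the
   Serre relations. *)
Record bkm_ops (V : lmodType K) := BkmOps {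
  op_e : 'I_n -> {linear V -> V};
  op_f : 'I_n -> {linear V -> V};
  op_h : cartan H -> {linear V -> V};
  op_hD : forall h h' v, op_h (h + h') v = op_h h v + op_h h' v;
  op_hZ : forall (c : K) h v, op_h (c *: h) v = c *: op_h h v;
  op_hh : forall h h' v, op_h h (op_h h' v) = op_h h' (op_h h v);
  op_he : forall h i v, op_h h (op_e i v) - op_e i (op_h h v)
    = (simple_root H i h : K) *: op_e i v;
  op_hf : forall h i v, op_h h (op_f i v) - op_f i (op_h h v)
    = - (simple_root H i h : K) *: op_f i v;
  op_ef : forall i j v, op_e i (op_f j v) - op_f j (op_e i v)
    = if i == j then op_h (simple_coroot H i) v else 0
}.

(** Contradicts the premises of the last four clauses of [bkm_eq], so that any [bkm_ops] yields a
    module over [bkm H]. *)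
Definition serre_free : Prop :=
  (forall i, ~~ (0 < A i i)) /\ (forall i j, A i j != 0).

Section OpsModule.
Variables (V : lmodType K) (o : bkm_ops V) (sf : serre_free).

Fixpoint term_act (x : bkm_term H) (v : V) : V :=
  match x with
  | TE i => op_e o i v
  | TF i => op_f o i v
  | TH h => op_h o h v
  | T0 => 0
  | Tadd x y => term_act x v + term_act y v
  | Topp x => - term_act x v
  | Tscale c x => c *: term_act x v
  | Tlie x y => term_act x (term_act y v) - term_act y (term_act x v)
  end.

Lemma term_act_linear x : linear (term_act x).
Proof.
elim: x => [i|i|h||x IHx y IHy|x IHx|c x IHx|x IHx y IHy] d u v /=.
- exact: linearP.
- exact: linearP.
- exact: linearP.
- by rewrite scaler0 addr0.
- by rewrite IHx IHy scalerDr addrACA.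
- by rewrite IHx opprD scalerN.
- by rewrite IHx scalerDr !scalerA mulrC.
- by rewrite IHx IHy IHx IHy scalerBr opprD addrACA.
Qed.

Lemma term_actD x u v : term_act x (u + v) = term_act x u + term_act x v.
Proof. by have := term_act_linear x 1 u v; rewrite !scale1r. Qed.

Lemma term_act0 x : term_act x 0 = 0.
Proof. by apply: (addrI (term_act x 0)); rewrite -term_actD !addr0. Qed.

Lemma term_actZ x c v : term_act x (c *: v) = c *: term_act x v.
Proof. by have := term_act_linear x c v 0; rewrite term_act0 !addr0. Qed.

Lemma term_actN x v : term_act x (- v) = - term_act x v.
Proof. by rewrite -scaleN1r term_actZ scaleN1r. Qed.

Lemma term_act_eq x y : bkm_eq x y -> forall v, term_act x v = term_act y v.
Proof.
have [Aii_le0 Aij_neq0] := sf; elim=> {x y} /=.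
- by [].
- by move=> x y _ E v; rewrite E.
- by move=> x y z _ E _ E' v; rewrite E E'.
- by move=> x x' y y' _ E _ E' v; rewrite E E'.
- by move=> x x' _ E v; rewrite E.
- by move=> c x x' _ E v; rewrite E.
- by move=> x x' y y' _ E _ E' v; rewrite !E !E'.
- by move=> x y z v; rewrite addrA.
- by move=> x y v; rewrite addrC.
- by move=> x v; rewrite add0r.
- by move=> x v; rewrite addNr.
- by move=> c d x v; rewrite scalerA.
- by move=> x v; rewrite scale1r.
- by move=> c x y v; rewrite scalerDr.
- by move=> x c d v; rewrite scalerDl.
- by move=> x y z v; rewrite term_actD opprD addrACA.
- by move=> c x y v; rewrite term_actZ scalerBr.
- by move=> x y z v; rewrite term_actD opprD addrACA.
- by move=> c x y v; rewrite term_actZ scalerBr.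
- by move=> x v; rewrite subrr.
- move=> x y z v; rewrite !(term_actD, term_actN) !opprB !addrA.
  (* Each of the six orders of [x], [y], [z] occurs twice with opposite signs; the pattern puts the
     twelve terms into cancelling pairs. *)
  rewrite [LHS](ACl (1*12*2*7*3*10*4*5*6*11*8*9))/=.
  by rewrite !(subrr, addNr, add0r, addrK, addrNK).
- by move=> h h' v; rewrite op_hD.
- by move=> c h v; rewrite op_hZ.
- by move=> h h' v; rewrite op_hh subrr.
- by move=> h i v; rewrite op_he.
- by move=> h i v; rewrite op_hf.
- by move=> i v; rewrite op_ef eqxx.
- by move=> i j /negPf ij v; rewrite op_ef ij.
- by move=> i j m _ /negPn; rewrite Aii_le0.
- by move=> i j m _ /negPn; rewrite Aii_le0.
- by move=> i j /eqP; rewrite (negPf (Aij_neq0 _ _)).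
- by move=> i j /eqP; rewrite (negPf (Aij_neq0 _ _)).
Qed.

(** An alias of [V] that remembers the operators, so that an action and its twist can live on the
    same space. *)
Definition ops_module of serre_free & bkm_ops V : Type := V.

HB.instance Definition _ := GRing.Lmodule.on (ops_module sf o).

Definition ops_act (x : bkm H) (v : ops_module sf o) : ops_module sf o :=
  term_act (repr x) v.

Lemma ops_actE x (v : V) : ops_act (bkm_pi x) v = term_act x v.
Proof.
by apply: term_act_eq; apply/bkm_piP; exact: bkm_surj.
Qed.

Let actDl x y v : ops_act (x + y) v = ops_act x v + ops_act y v.
Proof. by rewrite -(bkm_surj x) -(bkm_surj y) -bkm_piD !ops_actE. Qed.

Let actZl (c : K) x v : ops_act (c *: x) v = c *: ops_act x v.
Proof. by rewrite -(bkm_surj x) -bkm_piZ !ops_actE. Qed.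

Let actDr x v w : ops_act x (v + w) = ops_act x v + ops_act x w.
Proof. exact: term_actD. Qed.

Let actZr (c : K) x v : ops_act x (c *: v) = c *: ops_act x v.
Proof. exact: term_actZ. Qed.

Let act_lie x y v :
  ops_act (lie x y) v = ops_act x (ops_act y v) - ops_act y (ops_act x v).
Proof.
by rewrite -(bkm_surj x) -(bkm_surj y) [lie _ _]bkm_lieE !ops_actE.
Qed.

HB.instance Definition _ := Lmodule_isLieModule.Build K (bkm H)
  (ops_module sf o) actDl actZl actDr actZr act_lie.

Lemma ops_lact_e i (v : ops_module sf o) : lact (bkm_e H i) v = op_e o i v.
Proof. exact: ops_actE. Qed.

Lemma ops_lact_f i (v : ops_module sf o) : lact (bkm_f H i) v = op_f o i v.
Proof. exact: ops_actE. Qed.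

Lemma ops_lact_h h (v : ops_module sf o) : lact (bkm_h h) v = op_h o h v.
Proof. exact: ops_actE. Qed.

End OpsModule.

Section Twist.
Variables (V : lmodType K) (o : bkm_ops V).

Let e i : {linear V -> V} := \- op_f o i.
Let f i : {linear V -> V} := \- op_e o i.
Let h k : {linear V -> V} := \- op_h o k.

Fact twist_hD k l v : h (k + l) v = h k v + h l v.
Proof. by rewrite /= op_hD opprD. Qed.

Fact twist_hZ (c : K) k v : h (c *: k) v = c *: h k v.
Proof. by rewrite /= op_hZ scalerN. Qed.

Fact twist_hh k l v : h k (h l v) = h l (h k v).
Proof.
by rewrite /= (linearN (op_h o k)) (linearN (op_h o l)) op_hh.
Qed.

Fact twist_he k i v :
  h k (e i v) - e i (h k v) = (simple_root H i k : K) *: e i v.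
Proof.
rewrite /= (linearN (op_h o k)) (linearN (op_f o i)) opprK.
by rewrite scalerN -scaleNr -op_hf opprK.
Qed.

Fact twist_hf k i v :
  h k (f i v) - f i (h k v) = - (simple_root H i k : K) *: f i v.
Proof.
rewrite /= (linearN (op_h o k)) (linearN (op_e o i)) opprK.
by rewrite scalerN scaleNr -op_he !opprK.
Qed.

Fact twist_ef i j v : e i (f j v) - f j (e i v)
  = if i == j then h (simple_coroot H i) v else 0.
Proof.
rewrite /= (linearN (op_e o j)) (linearN (op_f o i)) !opprK.
rewrite -opprB op_ef eq_sym.
by case: eqP => [->|_]; rewrite // oppr0.
Qed.

(* The pull-back along the Chevalley involution. *)
Definition twist_ops : bkm_ops V :=
  BkmOps twist_hD twist_hZ twist_hh twist_he twist_hf twist_ef.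

End Twist.
End BKMTheory.

(** * Verma modules: universal property and spanning words *)

Section VermaTheory.
Variables (K : numFieldType) (n : nat) (A : 'M[K]_n) (H : realization A).
Variable lam : 'Hom(cartan H, K^o).

Lemma verma_ind (P : verma lam -> Prop) :
  P (verma_hw lam) -> P 0 -> (forall u v, P u -> P v -> P (u + v)) ->
  (forall (c : K) v, P v -> P (c *: v)) ->
  (forall x v, P v -> P (lact x v)) -> forall v, P v.
Proof.
move=> Phw P0 PD PZ PA v; rewrite -(verma_surj v).
elim: (repr v) => {v} [|||v Pv|c v Pv|x v Pv] //.
- by move=> u Pu v Pv; rewrite verma_piD; exact: PD.
- by rewrite verma_piN -scaleN1r; exact: PZ.
- by rewrite verma_piZ; exact: PZ.
- by rewrite -verma_actE; exact: PA.
Qed.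

Lemma verma_hw_killed : killed_by_nplus (verma_hw lam).
Proof.
move=> x nx; rewrite [LHS]verma_actE -verma_pi0.
by apply/verma_piP; exact: verma_nplus.
Qed.

Lemma verma_hw_weight : weight_space lam (verma_hw lam).
Proof.
move=> h; rewrite [LHS]verma_actE -verma_piZ.
by apply/verma_piP; exact: verma_cartan.
Qed.

Section Lift.
Variables (V : lieModType (bkm H)) (v0 : V).

Fixpoint lift_term (t : verma_term H) : V :=
  match t with
  | Vhw => v0
  | V0 => 0
  | Vadd s t => lift_term s + lift_term t
  | Vopp t => - lift_term t
  | Vscale c t => c *: lift_term t
  | Vact x t => lact x (lift_term t)
  end.

Definition verma_lift (v : verma lam) : V := lift_term (repr v).

Hypotheses (v0lam : weight_space lam v0) (v0max : killed_by_nplus v0).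

Lemma lift_term_eq s t : verma_eq lam s t -> lift_term s = lift_term t.
Proof.
elim=> {s t} /=.
- by [].
- by move=> s t _ ->.
- by move=> s t u _ -> _ ->.
- by move=> s s' t t' _ -> _ ->.
- by move=> s t _ ->.
- by move=> c s t _ ->.
- by move=> x s t _ ->.
- by move=> s t u; rewrite addrA.
- by move=> s t; rewrite addrC.
- by move=> s; rewrite add0r.
- by move=> s; rewrite addNr.
- by move=> c d s; rewrite scalerA.
- by move=> s; rewrite scale1r.
- by move=> c s t; rewrite scalerDr.
- by move=> s c d; rewrite scalerDl.
- by move=> x y s; rewrite lactDl.
- by move=> c x s; rewrite lactZl.
- by move=> x s t; rewrite lactDr.
- by move=> c x s; rewrite lactZr.
- by move=> x y s; rewrite lact_lie.
- by move=> x /v0max.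
- by move=> h; rewrite v0lam.
Qed.

Lemma verma_lift_pi t : verma_lift (verma_pi lam t) = lift_term t.
Proof. by apply: lift_term_eq; apply/verma_piP; exact: verma_surj. Qed.

Lemma verma_lift_hw : verma_lift (verma_hw lam) = v0.
Proof. exact: verma_lift_pi. Qed.

Lemma verma_lift_hom : lie_module_hom verma_lift.
Proof.
split=> [c u v|x v].
  rewrite -(verma_surj u) -(verma_surj v) -verma_piZ -verma_piD.
  by rewrite !verma_lift_pi.
by rewrite -(verma_surj v) [lact _ _]verma_actE !verma_lift_pi.
Qed.

End Lift.

(** Evaluation at the highest weight vector identifies homomorphisms with maximal vectors: it is
    injective because that vector generates, and surjective by [verma_lift_hom]. *)
Lemma hom_has_dim_maximal (V : lieModType (bkm H)) d :
  has_dim (maximal_space (V := V) lam) d -> hom_has_dim (verma lam) V d.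
Proof.
move=> [v [vP indep span]]; exists (fun i => verma_lift (v i)).
have liftE i : verma_lift (v i) (verma_hw lam) = v i.
  by have [] := vP i; exact: verma_lift_hw.
have lifth i : lie_module_hom (verma_lift (v i)).
  by have [] := vP i; exact: verma_lift_hom.
split=> // [c c0|g gh].
  apply: indep; rewrite -[RHS](c0 (verma_hw lam)).
  by apply: eq_bigr => i _; rewrite liftE.
have [|c gE] := span (g (verma_hw lam)).
  split=> [h|x nx]; rewrite -gh.2.
    by rewrite verma_hw_weight lie_homZ.
  by rewrite verma_hw_killed // lie_hom0.
exists c; apply: verma_ind.
- by rewrite gE; apply: eq_bigr => i _; rewrite liftE.
- by rewrite lie_hom0 // big1 // => i _; rewrite lie_hom0 ?scaler0.
- move=> u w gu gw; rewrite (lie_homD _ _ gh) gu gw -big_split.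
  by apply: eq_bigr => i _; rewrite (lie_homD _ _ (lifth i)) scalerDr.
- move=> k u gu; rewrite (lie_homZ _ _ gh) gu scaler_sumr.
  by apply: eq_bigr => i _; rewrite (lie_homZ _ _ (lifth i)) !scalerA mulrC.
- move=> x u gu; rewrite gh.2 gu lact_sum.
  by apply: eq_bigr => i _; rewrite (lifth i).2 lactZr.
Qed.

Definition fword_vec (w : seq 'I_n) : verma lam :=
  foldr (fun i => lact (bkm_f H i)) (verma_hw lam) w.

Definition word_wt (w : seq 'I_n) : 'Hom(cartan H, K^o) :=
  \sum_(i <- w) simple_root H i.

Lemma word_wt_cons i w : word_wt (i :: w) = simple_root H i + word_wt w.
Proof. exact: big_cons. Qed.

Lemma fword_vec_weight w : weight_space (lam - word_wt w) (fword_vec w).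
Proof.
elim: w => [|i w IHw].
  by rewrite /word_wt big_nil subr0; exact: verma_hw_weight.
by rewrite word_wt_cons opprD addrCA addrC; exact: weight_space_f.
Qed.

(** The span of the words is a submodule: [f_i] lengthens a word, [h] scales it, and [e_i] is moved
    to the right past the letters until it meets the highest weight vector. *)
Lemma verma_span (P : verma lam -> Prop) :
  P 0 -> (forall u v, P u -> P v -> P (u + v)) ->
  (forall (c : K) v, P v -> P (c *: v)) ->
  (forall w, P (fword_vec w)) -> forall v, P v.
Proof.
move=> P0 PD PZ Pf.
(* [P] may be larger than the span and unstable under the action; [Q] is the span itself, as the
   intersection of all subspaces containing the words. *)
pose Q v := forall P' : verma lam -> Prop, P' 0 ->
  (forall u v, P' u -> P' v -> P' (u + v)) ->
  (forall (c : K) v, P' v -> P' (c *: v)) ->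
  (forall w, P' (fword_vec w)) -> P' v.
have Qspan v : Q v -> P v by move=> /(_ P); exact.
have Q0 : Q 0 by [].
have QD u v : Q u -> Q v -> Q (u + v).
  by move=> Qu Qv P' p0 pD pZ pf;
    exact: pD (Qu _ p0 pD pZ pf) (Qv _ p0 pD pZ pf).
have QZ (c : K) v : Q v -> Q (c *: v).
  by move=> Qv P' p0 pD pZ pf; exact: pZ (Qv _ p0 pD pZ pf).
have Qf w : Q (fword_vec w) by move=> P' _ _ _; exact.
have QA x : (forall w, Q (lact x (fword_vec w))) -> forall v, Q v ->
  Q (lact x v).
  move=> Qx v /(_ (fun v => Q (lact x v))); apply=> //.
  - by rewrite lact0r.
  - by move=> u' v' Qu Qv; rewrite lactDr; exact: QD.
  - by move=> c v' Qv; rewrite lactZr; exact: QZ.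
have Qh h w : Q (lact (bkm_h h) (fword_vec w)).
  by rewrite fword_vec_weight; exact: QZ.
have Qff i v : Q v -> Q (lact (bkm_f H i) v).
  by apply: QA => w; exact: (Qf (i :: w)).
move=> v; apply: Qspan; elim/verma_ind: v => //; first exact: (Qf [::]).
move=> x v Qv; elim/bkm_ind: x v Qv.
- move=> i; apply: QA => w; elim: w => [|j w IHw].
    by rewrite /= verma_hw_killed //; exact: nplus_e.
  have := lact_lie (bkm_e H i) (bkm_f H j) (fword_vec w).
  rewrite lie_ef => /esym/eqP; rewrite subr_eq /= => /eqP ->.
  apply: QD; last exact: Qff.
  by case: eqP => _; [exact: Qh | rewrite lact0l].
- by move=> i v Qv; exact: Qff.
- by move=> h; apply: QA => w; exact: Qh.
- by move=> v Qv; rewrite lact0l.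
- by move=> x y Qx Qy v Qv; rewrite lactDl; apply: QD; [exact: Qx|exact: Qy].
- by move=> c x Qx v Qv; rewrite lactZl; apply: QZ; exact: Qx.
- move=> x y Qx Qy v Qv; rewrite lact_lie -scaleN1r.
  by apply: QD; [|apply: QZ]; [apply: Qx; exact: Qy | apply: Qy; exact: Qx].
Qed.

End VermaTheory.

(** * Coordinates on Verma modules *)

Section WordModule.
Variables (K : numFieldType) (n : nat) (A : 'M[K]_n) (H : realization A).
Variable lam : 'Hom(cartan H, K^o).

(** Finite support is not imposed: each coefficient of [e_i G], [f_i G] or [h G] depends on finitely
    many values of [G], and the pointwise operations already form a [K]-module. *)
Definition word_fun := seq 'I_n -> K^o.
HB.instance Definition _ := GRing.Lmodule.on word_fun.

(** The eigenvalue of [h] on the word [u]. *)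
Definition word_coef (h : cartan H) (u : seq 'I_n) : K :=
  lam h - word_wt H u h.

Lemma word_coef_cons h i u :
  word_coef h (i :: u) = word_coef h u - simple_root H i h.
Proof. by rewrite /word_coef word_wt_cons add_lfunE opprD addrCA addrC. Qed.

(* The coefficient of the word [u] in [e_i] applied to [\sum_w G w * w]: the
   first summand deletes the leading letter of [i :: u], the second one deletes
   a letter further to the right. *)
Fixpoint word_e i (u : seq 'I_n) (G : word_fun) : K :=
  word_coef (simple_coroot H i) u * G (i :: u)
  + if u is j :: u' then word_e i u' (fun x => G (j :: x)) else 0.

Definition word_f i (u : seq 'I_n) (G : word_fun) : K :=
  if u is j :: u' then if j == i then G u' else 0 else 0.

Definition word_h h (u : seq 'I_n) (G : word_fun) : K := word_coef h u * G u.

Lemma eq_word_e i u (G G' : word_fun) : G =1 G' -> word_e i u G = word_e i u G'.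
Proof. by move=> /funext ->. Qed.

Lemma word_e_eq0 i u (G : word_fun) :
  (forall w, perm_eq w (i :: u) -> G w = 0) -> word_e i u G = 0.
Proof.
elim: u G => [|j u IHu] G G0 /=; rewrite G0 // mulr0 add0r // IHu // => w pw.
apply: G0; apply: (@perm_trans _ (j :: i :: u)); first by rewrite perm_cons.
by rewrite (perm_catCA [:: j] [:: i] u).
Qed.

Lemma word_e_lin i u (c : K) (G G' : word_fun) :
  word_e i u (fun x => c * G x + G' x) = c * word_e i u G + word_e i u G'.
Proof.
elim: u G G' => [|j u IHu] G G' /=.
  by rewrite !addr0 mulrDr mulrCA.
rewrite (IHu (fun x => G (j :: x)) (fun x => G' (j :: x))).
by rewrite !mulrDr mulrCA addrACA.
Qed.

Definition word_op_e i (G : word_fun) : word_fun := word_e i ^~ G.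
Definition word_op_f i (G : word_fun) : word_fun := word_f i ^~ G.
Definition word_op_h h (G : word_fun) : word_fun := word_h h ^~ G.

Fact word_op_e_linear i : linear (word_op_e i).
Proof. by move=> c G G'; apply/funext => u; exact: word_e_lin. Qed.

Fact word_op_f_linear i : linear (word_op_f i).
Proof.
move=> c G G'; apply/funext => -[|j u]; rewrite /word_op_f /word_f !fctE.
  by rewrite scaler0 addr0.
by case: ifP => // _; rewrite scaler0 addr0.
Qed.

Fact word_op_h_linear h : linear (word_op_h h).
Proof.
move=> c G G'; apply/funext => u; rewrite /word_op_h /word_h !fctE.
by rewrite mulrDr mulrCA.
Qed.

HB.instance Definition _ i :=
  GRing.isLinear.Build K word_fun word_fun *:%R _ (word_op_e_linear i).
HB.instance Definition _ i :=
  GRing.isLinear.Build K word_fun word_fun *:%R _ (word_op_f_linear i).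
HB.instance Definition _ h :=
  GRing.isLinear.Build K word_fun word_fun *:%R _ (word_op_h_linear h).

(** For [k = 0] this is the relation between [h] and [e_i]; the constant absorbs the root of the
    leading letter that the induction strips off. *)
Lemma word_e_h i h (k : K) u (G : word_fun) :
  word_e i u (fun x => (k + word_coef h x) * G x)
  = (k + word_coef h u - simple_root H i h) * word_e i u G.
Proof.
elim: u k G => [|j u IHu] k G /=.
  by rewrite !addr0 mulrCA word_coef_cons !addrA.
rewrite mulrCA (word_coef_cons h i) addrA mulrDr; congr (_ + _).
transitivity (word_e i u
    (fun x => (k - simple_root H j h + word_coef h x) * G (j :: x))).
  by apply: eq_word_e => x; rewrite word_coef_cons (addrA k) (addrAC k).
by rewrite IHu word_coef_cons (addrA k) (addrAC k).
Qed.

Fact word_op_hD h h' G :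
  word_op_h (h + h') G = word_op_h h G + word_op_h h' G.
Proof.
apply/funext => u; rewrite /word_op_h /word_h fctE -mulrDl; congr (_ * _).
by rewrite /word_coef (linearD lam) (linearD (word_wt H u))
  opprD addrACA.
Qed.

Fact word_op_hZ (c : K) h G : word_op_h (c *: h) G = c *: word_op_h h G.
Proof.
apply/funext => u; transitivity (c * (word_coef h u * G u)); last by [].
rewrite mulrA; congr (_ * _).
by rewrite /word_coef (linearZZ lam) (linearZZ (word_wt H u)) mulrBr.
Qed.

Fact word_op_hh h h' G :
  word_op_h h (word_op_h h' G) = word_op_h h' (word_op_h h G).
Proof. by apply/funext => u; exact: mulrCA. Qed.

Fact word_op_he h i G : word_op_h h (word_op_e i G) - word_op_e i (word_op_h h
  G)
  = (simple_root H i h : K) *: word_op_e i G.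
Proof.
apply/funext => u.
change (word_coef h u * word_e i u G
  - word_e i u (fun x => word_coef h x * G x)
      = simple_root H i h * word_e i u G).
have -> : word_e i u (fun x => word_coef h x * G x)
    = (word_coef h u - simple_root H i h) * word_e i u G.
  rewrite -[word_coef h u]add0r -word_e_h.
  by apply: eq_word_e => x; rewrite add0r.
by rewrite (mulrBl _ (word_coef h u)) opprB addrC subrK.
Qed.

Fact word_op_hf h i G : word_op_h h (word_op_f i G) - word_op_f i (word_op_h h
  G)
  = - (simple_root H i h : K) *: word_op_f i G.
Proof.
apply/funext => -[|j u].
  change (word_coef h [::] * 0 - 0 = - (simple_root H i h : K) * 0).
  by rewrite !mulr0 subr0.
change (word_coef h (j :: u) * (if j == i then G u else 0)
  - (if j == i then word_coef h u * G u else 0)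
  = - (simple_root H i h : K) * (if j == i then G u else 0)).
have [->|_] := eqVneq j i; last by rewrite !mulr0 subr0.
by rewrite word_coef_cons (mulrBl _ (word_coef h u)) addrAC subrr add0r mulNr.
Qed.

(** At a nonempty word the summand of [word_e] that keeps the leading letter cancels against
    [f_j e_i]. What remains deletes the letter just prepended by [f_j], with the eigenvalue of the
    coroot as coefficient. *)
Fact word_op_ef i j G : word_op_e i (word_op_f j G) - word_op_f j (word_op_e i
  G)
  = if i == j then word_op_h (simple_coroot H i) G else 0.
Proof.
apply/funext => u.
change (word_e i u (fun x => word_f j x G) - word_f j u (fun x => word_e i x G)
  = (if i == j then word_op_h (simple_coroot H i) G else 0) u).
have -> : (if i == j then word_op_h (simple_coroot H i) G else 0) u
    = if i == j then word_coef (simple_coroot H i) u * G u else 0.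
  by case: ifP.
case: u => [|k u] /=.
  by case: ifP => _; rewrite ?mulr0 !addr0 subr0.
have -> : word_e i u (fun x => if k == j then G x else 0)
    = if k == j then word_e i u G else 0.
  by case: ifP => // _; exact: word_e_eq0.
by rewrite addrK; case: ifP; rewrite // mulr0.
Qed.

Definition word_ops : bkm_ops H word_fun :=
  BkmOps word_op_hD word_op_hZ word_op_hh word_op_he word_op_hf word_op_ef.

End WordModule.

Section Coordinates.
Variables (K : numFieldType) (n : nat) (A : 'M[K]_n) (H : realization A).
Variables (sf : serre_free A) (lam : 'Hom(cartan H, K^o)).

Lemma word_wt_count w :
  word_wt H w = \sum_i (count_mem i w)%:R *: simple_root H i.
Proof.
elim: w => [|j w IHw].
  by rewrite /word_wt big_nil big1 // => i _; rewrite scale0r.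
rewrite word_wt_cons IHw; under [RHS]eq_bigr do rewrite /= natrD scalerDl.
rewrite big_split /=; congr (_ + _); rewrite (bigD1 j) //= eqxx scale1r.
by rewrite big1 ?addr0 // => i /negPf ij; rewrite eq_sym ij scale0r.
Qed.

Lemma word_wt_perm u w : perm_eq u w -> word_wt H u = word_wt H w.
Proof. exact: perm_big. Qed.

(** The simple roots are free and [K] has characteristic 0, so a weight determines the number of
    occurrences of each letter. *)
Lemma word_wt_inj u w : word_wt H u = word_wt H w -> perm_eq u w.
Proof.
rewrite !word_wt_count => /eqP; rewrite -subr_eq0 -sumrB => /eqP sum0.
have /freeP indep := simple_root_free H.
have {}indep i := indep (fun i => (count_mem i u)%:R - (count_mem i w)%:R) _ i.
apply/allP => i _ /=; rewrite -(eqr_nat K) -subr_eq0; apply/eqP; apply: indep.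
rewrite -[RHS]sum0; apply: eq_bigr => j _.
by rewrite scalerBl -tnth_nth tnth_mktuple.
Qed.

Let model := ops_module sf (word_ops lam).

Definition word_one : model := fun u => (u == [::])%:R.

Fact word_one_weight : weight_space lam word_one.
Proof.
move=> h; rewrite ops_lact_h; apply/funext => u.
change (word_coef lam h u * (u == [::])%:R = lam h * (u == [::])%:R).
by case: u => [|i u]; rewrite ?mulr0 // /word_coef /word_wt big_nil lfunE subr0.
Qed.

Fact word_one_killed : killed_by_nplus word_one.
Proof.
apply/killed_by_nplusP => i; rewrite ops_lact_e; apply/funext => u.
by apply: word_e_eq0 => -[|j w] // /perm_size.
Qed.

Definition word_coord : verma lam -> word_fun K n := verma_lift word_one.

Lemma word_coord_hom : lie_module_hom (word_coord : verma lam -> model).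
Proof. exact: verma_lift_hom word_one_weight word_one_killed. Qed.

Lemma word_coord0 u : word_coord 0 u = 0.
Proof. by rewrite (lie_hom0 word_coord_hom). Qed.

Lemma word_coordD v w u : word_coord (v + w) u = word_coord v u
  + word_coord w u.
Proof. by rewrite (lie_homD _ _ word_coord_hom). Qed.

Lemma word_coordZ (c : K) v u : word_coord (c *: v) u = c * word_coord v u.
Proof. by rewrite (lie_homZ _ _ word_coord_hom). Qed.

Lemma word_coord_sum (I : Type) (r : seq I) (c : I -> K) (F : I ->
  verma lam) u :
  word_coord (\sum_(i <- r) c i *: F i) u
    = \sum_(i <- r) c i * word_coord (F i) u.
Proof.
elim: r => [|i r IHr]; first by rewrite !big_nil word_coord0.
by rewrite !big_cons word_coordD word_coordZ IHr.
Qed.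

Lemma word_coord_e i v u : word_coord (lact (bkm_e H i) v) u
  = word_e lam i u (word_coord v).
Proof. by rewrite word_coord_hom.2 ops_lact_e. Qed.

Lemma word_coord_f i v u : word_coord (lact (bkm_f H i) v) u
  = word_f i u (word_coord v).
Proof. by rewrite word_coord_hom.2 ops_lact_f. Qed.

Lemma word_coord_h h v u :
  word_coord (lact (bkm_h h) v) u = word_coef lam h u * word_coord v u.
Proof. by rewrite word_coord_hom.2 ops_lact_h. Qed.

(** Together with [verma_span] this makes the words a basis of [verma lam], with [word_coord]
    reading off coordinates. *)
Lemma word_coord_fword w u : word_coord (fword_vec lam w) u = (u == w)%:R.
Proof.
elim: w u => [|i w IHw] u.
  by rewrite /word_coord (verma_lift_hw word_one_weight word_one_killed).
rewrite word_coord_f; case: u => [|j u] //=; rewrite IHw eqseq_cons.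
by case: eqP.
Qed.

Lemma word_coord_eq0 v : (forall u, word_coord v u = 0) -> v = 0.
Proof.
(* Allowing every duplicate-free [S'] above [S] lets the expansions of two vectors be added over a
   common index set. *)
suff [S vS] : exists S : seq (seq 'I_n), forall S', uniq S' ->
  {subset S <= S'} ->
    v = \sum_(w <- S') word_coord v w *: fword_vec lam w.
  move=> v0; rewrite (vS (undup S)) ?undup_uniq //.
    by rewrite big1 // => w _; rewrite v0 scale0r.
  by move=> w; rewrite mem_undup.
move: v; apply: verma_span => [|u v [S uS] [T vT]|c v [S vS]|w].
- by exists [::] => S _ _; rewrite big1 // => w _; rewrite word_coord0 scale0r.
- exists (S ++ T) => S' uS' sS'.
  under eq_bigr do rewrite word_coordD scalerDl.
  rewrite big_split -(uS S') //; last by move=> w wS; rewrite sS' // mem_cat wS.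
  by rewrite -(vT S') // => w wT; rewrite sS' // mem_cat wT orbT.
- exists S => S' uS' sS'; under eq_bigr do rewrite word_coordZ -scalerA.
  by rewrite -scaler_sumr -vS.
- exists [:: w] => S' uS' sS'; rewrite (bigD1_seq w) //=; last first.
    by rewrite sS' ?mem_head.
  rewrite word_coord_fword eqxx scale1r big1 ?addr0 // => u /negPf uw.
  by rewrite word_coord_fword uw scale0r.
Qed.

Lemma word_coord_inj v w : word_coord v =1 word_coord w -> v = w.
Proof.
move=> vw; apply/eqP; rewrite -subr_eq0; apply/eqP; apply: word_coord_eq0 => u.
by rewrite -scaleN1r word_coordD word_coordZ vw mulN1r subrr.
Qed.

Lemma word_coord_surj w0 (G : word_fun K n) :
  (forall u, ~~ perm_eq u w0 -> G u = 0) -> exists v, word_coord v =1 G.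
Proof.
move=> G0; exists (\sum_(w <- permutations w0) G w *: fword_vec lam w) => u.
rewrite word_coord_sum; under eq_bigr do rewrite word_coord_fword.
have [uw|uw] := boolP (perm_eq u w0); last first.
  rewrite G0 // big_seq big1 // => w; rewrite mem_permutations => ww.
  by case: eqP => [uw'|_]; [rewrite uw' ww in uw | rewrite mulr0].
rewrite (bigD1_seq u) ?permutations_uniq ?mem_permutations //= eqxx mulr1.
by rewrite big1 ?addr0 // => w /negPf uw'; rewrite eq_sym uw' mulr0.
Qed.

Lemma weight_space_coord w0 v : weight_space (lam - word_wt H w0) v <->
  (forall u, ~~ perm_eq u w0 -> word_coord v u = 0).
Proof.
split=> [vw u|vw h].
  apply: contraNeq => v0.
  apply: word_wt_inj; apply/lfunP => h.
  have /eqP := word_coord_h h v u; rewrite vw word_coordZ.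
  rewrite -subr_eq0 -mulrBl mulf_eq0 (negPf v0) orbF subr_eq0 => /eqP.
  by rewrite add_lfunE opp_lfunE => /addrI/oppr_inj.
apply: word_coord_inj => u; rewrite word_coord_h word_coordZ.
have [uw|uw] := boolP (perm_eq u w0); last by rewrite vw ?mulr0.
by rewrite add_lfunE opp_lfunE -(word_wt_perm uw).
Qed.

(** The coefficient of [e_i v] at [u] involves [v] only at permutations of [i :: u]; these
    coordinates vanish unless [i :: u] has the letters of [w0], which leaves a finite system. *)
Lemma killed_by_nplus_coord w0 v : weight_space (lam - word_wt H w0) v ->
  killed_by_nplus v <->
  (forall i u, perm_eq (i :: u) w0 -> word_e lam i u (word_coord v) = 0).
Proof.
move=> /weight_space_coord vw; split=> [vk i u _|vk].
  by rewrite -word_coord_e vk ?word_coord0 //; exact: nplus_e.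
apply/killed_by_nplusP => i; apply: word_coord_eq0 => u; rewrite word_coord_e.
have [iu|iu] := boolP (perm_eq (i :: u) w0); first exact: vk.
apply: word_e_eq0 => w ww; apply: vw; apply: contraNN iu.
by move=> ww0; rewrite -(permPl ww).
Qed.

End Coordinates.

(** * Root spaces *)

Section RootSpaces.
Variables (K : numFieldType) (n : nat) (A : 'M[K]_n) (H : realization A).

Definition bkm_gen (b : bool) i : bkm H := if b then bkm_e H i else bkm_f H i.

Definition bkm_ad b (w : seq 'I_n) k : bkm H :=
  foldr (fun i => lie (bkm_gen b i)) (bkm_gen b k) w.

Lemma root_space0 mu : root_space mu (0 : bkm H).
Proof. by move=> h; rewrite lie0r scaler0. Qed.

Lemma root_spaceD mu (x y : bkm H) :
  root_space mu x -> root_space mu y -> root_space mu (x + y).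
Proof. by move=> xmu ymu h; rewrite lieDr xmu ymu scalerDr. Qed.

Lemma root_spaceZ mu (c : K) (x : bkm H) :
  root_space mu x -> root_space mu (c *: x).
Proof. by move=> xmu h; rewrite lieZr xmu !scalerA mulrC. Qed.

Lemma root_space_lie mu nu (x y : bkm H) :
  root_space mu x -> root_space nu y -> root_space (mu + nu) (lie x y).
Proof.
move=> xmu ynu h; rewrite lie_leibniz xmu ynu lieZl lieZr -scalerDl.
by rewrite add_lfunE.
Qed.

Lemma root_space_gen b i :
  root_space (if b then simple_root H i else - simple_root H i) (bkm_gen b i).
Proof. by case: b => h; rewrite ?opp_lfunE (lie_he, lie_hf). Qed.

Lemma root_space_ad b w k : root_space
  (if b then word_wt H (rcons w k) else - word_wt H (rcons w k)) (bkm_ad b w k).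
Proof.
elim: w => [|i w IHw] /=.
  by rewrite /word_wt big_seq1; exact: root_space_gen.
have := root_space_lie (root_space_gen b i) IHw; rewrite word_wt_cons.
by case: b {IHw} => //; rewrite opprD.
Qed.

Lemma lie_gen_opp b i j : exists c : K,
  lie (bkm_gen b i) (bkm_gen (~~ b) j) = c *: bkm_h (simple_coroot H i).
Proof.
case: b => /=; last rewrite lieC; rewrite lie_ef; case: eqP => [->|_].
- by exists 1; rewrite scale1r.
- by exists 0; rewrite scale0r.
- by exists (- 1); rewrite scaleN1r.
- by exists 0; rewrite scale0r oppr0.
Qed.

(** The spanning half of the triangular decomposition. A generator lengthens a bracket of its own
    sign; against a bracket of the opposite sign the Leibniz rule moves it inwards until it meets
    its coroot. *)
Lemma bkm_span (P : bkm H -> Prop) :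
  P 0 -> (forall x y, P x -> P y -> P (x + y)) ->
  (forall (c : K) x, P x -> P (c *: x)) -> (forall h, P (bkm_h h)) ->
  (forall b w k, P (bkm_ad b w k)) -> forall x, P x.
Proof.
move=> P0 PD PZ Ph Pad.
pose lin (P' : bkm H -> Prop) := [/\ P' 0, forall x y, P' x -> P' y ->
  P' (x + y)
  & forall (c : K) x, P' x -> P' (c *: x)].
pose Q (S : bool -> bool) x := forall P' : bkm H -> Prop, lin P' ->
  (forall h, P' (bkm_h h)) ->
  (forall b w k, S b -> P' (bkm_ad b w k)) -> P' x.
have Q0 S : Q S 0 by move=> P' [].
have QD S x y : Q S x -> Q S y -> Q S (x + y).
  by move=> Qx Qy P' l; case: (l) => _ lD _ h a;
    exact: lD (Qx _ l h a) (Qy _ l h a).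
have QZ S (c : K) x : Q S x -> Q S (c *: x).
  by move=> Qx P' l; case: (l) => _ _ lZ h a; exact: lZ (Qx _ l h a).
have Qh S h : Q S (bkm_h h) by move=> P' _ h' _; exact: h'.
have Qad (S : bool -> bool) b w k : S b -> Q S (bkm_ad b w k).
  by move=> Sb P' _ _; exact.
have Qlin S x : lin (fun y => Q S (lie x y)).
  split=> [|y z Qy Qz|c y Qy]; first by rewrite lie0r.
    by rewrite lieDr; exact: QD.
  by rewrite lieZr; exact: QZ.
have Qlieh (S : bool -> bool) h x : Q S x -> Q S (lie (bkm_h h) x).
  move=> /(_ _ (Qlin S (bkm_h h))); apply=> [h'|b w k Sb].
    by rewrite lie_hh.
  by rewrite root_space_ad; apply: QZ; exact: Qad.
have Qgen (S : bool -> bool) b i x : S b -> (forall w k, S (~~ b) ->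
    Q S (lie (bkm_gen b i) (bkm_ad (~~ b) w k))) ->
    Q S x -> Q S (lie (bkm_gen b i) x).
  move=> Sb Sad /(_ _ (Qlin S (bkm_gen b i))); apply=> [h|b' w k Sb'].
    rewrite lieC root_space_gen -scaleN1r; do 2!apply: (QZ).
    exact: (Qad S b [::] i Sb).
  have [bb|bb] := eqVneq b' b.
    by rewrite bb; apply: (Qad _ _ (i :: w)); rewrite -bb.
  have -> : b' = ~~ b by case: b' b bb {Sb Sad Sb'} => [] [].
  by apply: Sad; case: b' b bb Sb' {Sb} => [] [].
have Qopp b i w k : Q (pred1 (~~ b)) (lie (bkm_gen b i) (bkm_ad (~~ b) w k)).
  elim: w => [|j w IHw] /=.
    by have [c ->] := lie_gen_opp b i k; apply: QZ; exact: Qh.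
  rewrite lie_leibniz; apply: QD.
    have [c ->] := lie_gen_opp b i j; rewrite lieZl; apply: QZ; apply: Qlieh.
    by apply: Qad => /=.
  apply: Qgen => //= w' k'; by case: (b).
suff Qx x : Q predT x.
  by move=> x; apply: Qx => // b w k _; exact: Pad.
have QT b y : Q (pred1 b) y -> Q predT y.
  by move=> Qy P' l h a; apply: Qy => // b' w k _; exact: a.
suff Qall : forall x y, Q predT y -> Q predT (lie x y).
  elim/bkm_ind: x => //.
  - by move=> i; exact: (Qad _ true [::]).
  - by move=> i; exact: (Qad _ false [::]).
  - by move=> x y; exact: QD.
  - by move=> c x; exact: QZ.
  - by move=> x y _; exact: Qall.
elim/bkm_ind=> {x}.
- by move=> i y; apply: (Qgen _ true) => // w k _; exact: QT (Qopp true i w k).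
- by move=> i y; apply: (Qgen _ false) => // w k _;
    exact: QT (Qopp false i w k).
- by move=> h y; exact: Qlieh.
- by move=> y _; rewrite lie0l.
- by move=> x y Qx Qy z Qz; rewrite lieDl; apply: QD; [exact: Qx | exact: Qy].
- by move=> c x Qx z Qz; rewrite lieZl; apply: QZ; exact: Qx.
- move=> x y Qx Qy z Qz.
  have -> : lie (lie x y) z = lie x (lie y z) + (- 1) *: lie y (lie x z).
    by rewrite lie_leibniz scaleN1r addrK.
  apply: QD; [|apply: QZ]; first by apply: Qx; exact: Qy.
  by apply: Qy; exact: Qx.
Qed.

(** For [h] separating the first root [nu] from [mu], the operator [ad h - nu h] removes the first
    summand, rescales the others and multiplies [z] by the nonzero scalar [mu h - nu h]. *)
Lemma root_space_sum_eq0 mu (s : seq ('Hom(cartan H, K^o) * bkm H)) :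
  (forall p, p \in s -> p.1 != mu /\ root_space p.1 p.2) ->
  forall c z, root_space mu z -> z = \sum_(p <- s) (c p : K) *: p.2 -> z = 0.
Proof.
elim: s => [|[nu x] s IHs] sP c z zmu; first by rewrite big_nil.
have [/= numu xnu] := sP (nu, x) (mem_head _ _).
have [h hP] : exists h, nu h != mu h.
  apply: contrapT => /forallNP hP; case/negP: numu; apply/eqP/lfunP => h.
  by apply/eqP; apply/negPn/negP; exact: hP.
rewrite big_cons /= => zE.
have zmu_nu : ((mu h : K) - nu h) *: z = 0.
  apply: (IHs _ (fun p => c p * ((p.1 h : K) - nu h))).
  - by move=> p ps; apply: sP; rewrite inE ps orbT.
  - exact: root_spaceZ.
  rewrite scalerBl -zmu {1 2}zE lieDr lieZr xnu scalerDr !scalerA mulrC.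
  rewrite opprD addrACA subrr add0r.
  have -> : lie (bkm_h h) (\sum_(p <- s) c p *: p.2)
      = \sum_(p <- s) (c p * (p.1 h : K)) *: p.2.
    have : forall p, p \in s -> root_space p.1 p.2.
      by move=> p ps; have [] := sP p; rewrite ?inE ?ps ?orbT.
    elim: (s) => [|p t IHt] tP; first by rewrite !big_nil lie0r.
    rewrite !big_cons lieDr lieZr tP ?mem_head // scalerA IHt // => q qt.
    by apply: tP; rewrite inE qt orbT.
  rewrite scaler_sumr -sumrB; apply: eq_bigr => p _.
  by rewrite scalerA -scalerBl mulrBr (mulrC (nu h)).
apply/eqP; move/eqP: zmu_nu; rewrite scaler_eq0 subr_eq0 eq_sym.
by rewrite (negPf hP).
Qed.

(** In an expansion given by [bkm_span], Cartan elements have root 0, [f]-brackets have negative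
    roots, and [e]-brackets in other letters have other roots by [word_wt_inj]. As [u] is nonempty,
    [root_space_sum_eq0] discards them all. *)
Lemma root_space_span (u : seq 'I_n) (P : bkm H -> Prop) : u != [::] ->
  P 0 -> (forall x y, P x -> P y -> P (x + y)) ->
  (forall (c : K) x, P x -> P (c *: x)) ->
  (forall w k, perm_eq (rcons w k) u -> P (bkm_ad true w k)) ->
  forall x, root_space (word_wt H u) x -> P x.
Proof.
move=> u0 P0 PD PZ Pad x xu.
suff [y [s [Py yu sP xE]]] : exists y (s : seq ('Hom(cartan H, K^o) * bkm H)),
    [/\ P y, root_space (word_wt H u) y,
      forall p, p \in s -> p.1 != word_wt H u /\ root_space p.1 p.2
      & x = y + \sum_(p <- s) p.2].
  suff xy0 : x - y = 0 by rewrite -(subrK y x) xy0 add0r.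
  apply: (root_space_sum_eq0 sP (c := fun=> 1)).
    by apply: root_spaceD => //; rewrite -scaleN1r; exact: root_spaceZ.
  by rewrite xE addrAC subrr add0r; apply: eq_bigr => p _; rewrite scale1r.
have other nu z : nu != word_wt H u -> root_space nu z ->
    exists y (s : seq ('Hom(cartan H, K^o) * bkm H)),
    [/\ P y, root_space (word_wt H u) y,
      forall p, p \in s -> p.1 != word_wt H u /\ root_space p.1 p.2
      & z = y + \sum_(p <- s) p.2].
  move=> nuu znu; exists 0, [:: (nu, z)]; split=> //.
  - exact: root_space0.
  - by move=> p; rewrite inE => /eqP ->.
  - by rewrite big_seq1 add0r.
elim/bkm_span: x {xu} => [|x y [y1 [s1 [? ? s1P ->]]] [y2 [s2 [? ? s2P ->]]]
  |c x [y [s [? ? sP ->]]]|h|[] w k].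
- by exists 0, [::]; split=> //; [exact: root_space0 | rewrite big_nil addr0].
- exists (y1 + y2), (s1 ++ s2); split.
  + exact: PD.
  + exact: root_spaceD.
  + by move=> p; rewrite mem_cat => /orP[/s1P|/s2P].
  + by rewrite big_cat addrACA.
- exists (c *: y), [seq (p.1, c *: p.2) | p <- s]; split.
  + exact: PZ.
  + exact: root_spaceZ.
  + by move=> _ /mapP[p /sP[pu pP] ->]; split=> //; exact: root_spaceZ.
  + by rewrite big_map scalerDr scaler_sumr.
- apply: (other 0).
    apply: contra u0 => /eqP u0; rewrite -size_eq0 -(perm_size (s1 := [::])) //.
    by apply: (word_wt_inj (H := H)); rewrite -u0 /word_wt big_nil.
  by move=> h'; rewrite lie_hh lfunE scale0r.
- have [wk|wk] := boolP (perm_eq (rcons w k) u).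
    exists (bkm_ad true w k), [::]; split=> //; first exact: Pad.
      by rewrite -(word_wt_perm _ wk); exact: (root_space_ad true).
    by rewrite big_nil addr0.
  apply: (other _ _ _ (root_space_ad true w k)).
  by apply: contra wk => /eqP; exact: word_wt_inj.
- apply: (other _ _ _ (root_space_ad false w k)).
  rewrite eq_sym -subr_eq0 opprK; apply: contra u0 => /eqP uw.
  suff /perm_size : perm_eq (u ++ rcons w k) [::].
    by rewrite size_cat size_rcons addnS.
  by apply: (word_wt_inj (H := H)); rewrite [LHS]big_cat [LHS]uw [RHS]big_nil.
Qed.

End RootSpaces.

(** * Multiplicities of [alpha_p + m alpha_q] and [2 alpha_p + 2 alpha_q] *)

Section RootMultiplicities.
Variables (K : numFieldType) (n : nat) (A : 'M[K]_n) (H : realization A).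
Variables (sf : serre_free A) (p q : 'I_n) (pq : p != q).

Lemma bkm_ad_rcons b w i k : bkm_ad H b (rcons w i) k =
  foldr (fun j => lie (bkm_gen H b j)) (lie (bkm_gen H b i) (bkm_gen H b k)) w.
Proof. by elim: w => //= j w ->. Qed.

Lemma bkm_ad_cons i w k :
  bkm_ad H true (i :: w) k = lie (bkm_e H i) (bkm_ad H true w k).
Proof. by []. Qed.

Lemma bkm_ad_nil k : bkm_ad H true [::] k = bkm_e H k.
Proof. by []. Qed.

Lemma foldr_lie0 b w : foldr (fun j => lie (bkm_gen H b j)) 0 w = 0.
Proof. by elim: w => //= j w ->; rewrite lie0r. Qed.

Lemma foldr_lieN b w x : foldr (fun j => lie (bkm_gen H b j)) (- x) w
  = - foldr (fun j => lie (bkm_gen H b j)) x w.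
Proof. by elim: w => //= j w ->; rewrite lieNr. Qed.

(* In this module the [e_i] act, up to sign, as the free generators of the
   algebra of words. *)
Let model := ops_module sf (twist_ops (word_ops (0 : 'Hom(cartan H, K^o)))).

Let lact_eE i (G : model) u : (lact (bkm_e H i) G : model) u = - word_f i u G.
Proof. by rewrite ops_lact_e. Qed.

Let lact_lieE x y (G : model) u : (lact (lie x y) G : model) u
  = (lact x (lact y G) : model) u - (lact y (lact x G) : model) u.
Proof. by rewrite lact_lie. Qed.

Let one : model := fun u => (u == [::])%:R.

(** The condition at the empty word gives stability under [e_p], which turns the empty word into the
    word [p]. *)
Let vanish_last (G : model) : Prop :=
  G [::] = 0 /\ forall u, G (rcons u p) = 0.

Let vanish_last_e i G : vanish_last G -> vanish_last (lact (bkm_e H i) G).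
Proof.
move=> [G0 Gp]; split=> [|[|j u]]; rewrite lact_eE /= ?oppr0 //.
  by case: ifP; rewrite ?G0 oppr0.
by case: ifP; rewrite ?Gp oppr0.
Qed.

Let vanish_last_ad m G :
  vanish_last G -> vanish_last (lact (bkm_ad H true (nseq m q) p) G).
Proof.
elim: m G => [|m IHm] G Gv; first exact: vanish_last_e.
have [v10 v1p] := vanish_last_e q (IHm _ Gv).
have [v20 v2p] := IHm _ (vanish_last_e q Gv).
by split=> [|u]; rewrite lact_lieE ?v10 ?v20 ?v1p ?v2p subrr.
Qed.

(** In the expansion of the bracket only the product [e_q^m e_p] applies [e_p] first; all others
    produce words ending in [q]. Hence the coefficient at [q^m p] is 1 or -1. *)
Lemma bkm_ad1n_neq0 m : bkm_ad H true (nseq m q) p != 0.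
Proof.
suff : (lact (bkm_ad H true (nseq m q) p) one : model) (rcons (nseq m q) p) !=
  0.
  by apply: contraNneq => ->; rewrite lact0l.
elim: m => [|m IHm].
  by rewrite lact_eE /= eqxx oppr_eq0 oner_eq0.
have onev : vanish_last (lact (bkm_e H q) one).
  split=> [|[|j u]]; rewrite lact_eE /= ?oppr0 ?(negPf pq) ?oppr0 //.
  by case: ifP => _; rewrite ?oppr0 //; case: u => [|k u];
    rewrite /one /= oppr0.
have [_ /(_ (q :: nseq m q)) /= v2] := vanish_last_ad m onev.
by rewrite lact_lieE v2 subr0 lact_eE /= eqxx oppr_eq0.
Qed.

(** The two innermost letters decide: [q q] gives 0, and replacing [p q] by [q p] changes the sign,
    so that [p] may be taken innermost. *)
Lemma root_space_1n m : has_dim (root_space (word_wt H (p :: nseq m q))) 1.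
Proof.
apply: (has_dim1 (v := bkm_ad H true (nseq m q) p)).
- rewrite -(@word_wt_perm _ _ _ H (rcons (nseq m q) p)) ?perm_rcons //.
  exact: (root_space_ad true).
- exact: bkm_ad1n_neq0.
apply: root_space_span => //.
- by exists 0; rewrite scale0r.
- by move=> _ _ [c ->] [d ->]; exists (c + d); rewrite scalerDl.
- by move=> c _ [d ->]; exists (c * d); rewrite scalerA.
have nseqE w l : perm_eq w (nseq l q) -> w = nseq l q.
  move=> wl; rewrite -(size_nseq l q) -(perm_size wl); apply/all_pred1P.
  by rewrite (perm_all _ wl) all_pred1_nseq.
move=> w k wk.
have [kp|kp] := eqVneq k p.
  exists 1; rewrite scale1r kp; congr bkm_ad; apply: nseqE.
  by rewrite -(perm_cons p) -(permPr wk) kp perm_sym perm_rcons.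
have letter j : j \in rcons w k -> j = p \/ j = q.
  rewrite (perm_mem wk) inE => /orP[/eqP|]; first by left.
  by move=> /nseqP[]; right.
have kq : k = q.
  by case: (letter k) => //; [rewrite mem_rcons mem_head | move/eqP: kp].
case: (lastP w) wk letter => [|w' j] wk letter.
  by have := perm_mem wk p; rewrite !inE eqxx eq_sym (negPf kp).
have [|jp|jq] := letter j;
  first by rewrite mem_rcons inE mem_rcons mem_head orbT.
- exists (-1); rewrite bkm_ad_rcons lieC foldr_lieN scaleN1r -bkm_ad_rcons kq
    jp.
  congr (- bkm_ad _ _ _ _); apply: nseqE; apply/permP => a.
  by have := permP wk a; rewrite kq jp -!cats1 !count_cat /=; lia.
- by exists 0; rewrite bkm_ad_rcons jq kq liexx foldr_lie0 scale0r.
Qed.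

(** By the Leibniz rule the two sides differ by the bracket of [[e_q, e_p]] with its own
    opposite. *)
Lemma lie_pq_commute : lie (bkm_e H q) (lie (bkm_e H p) (lie (bkm_e H p) (bkm_e
  H q)))
  = lie (bkm_e H p) (lie (bkm_e H q) (lie (bkm_e H p) (bkm_e H q))).
Proof.
rewrite [LHS]lie_leibniz (lieC (bkm_e H q) (bkm_e H p)).
by rewrite lieC lieNr liexx !oppr0 add0r.
Qed.

Lemma root_space_22 : has_dim (root_space (word_wt H [:: p; p; q; q])) 1.
Proof.
have qp : q != p by rewrite eq_sym.
apply: (has_dim1 (v := bkm_ad H true [:: p; q; p] q)).
- rewrite -(@word_wt_perm _ _ _ H (rcons [:: p; q; p] q)).
    exact: (root_space_ad true).
  by rewrite /= perm_cons (perm_catCA [:: q] [:: p] [:: q]).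
(* As a noncommutative polynomial, [[p, [q, [p, q]]]] contains the monomial [ppqq] with coefficient
   -1; the four signs from [lact_eE] cancel. *)
- suff : (lact (bkm_ad H true [:: p; q; p] q) one : model) [:: p; p; q; q] != 0.
    by apply: contraNneq => ->; rewrite lact0l.
  rewrite !bkm_ad_cons bkm_ad_nil.
  do 8!rewrite ?lact_lieE ?lact_eE /= ?eqxx ?(negPf pq) ?(negPf qp) /=.
  by rewrite !(oppr0, subr0, sub0r, opprK) oppr_eq0 oner_eq0.
apply: root_space_span => //.
- by exists 0; rewrite scale0r.
- by move=> _ _ [c ->] [d ->]; exists (c + d); rewrite scalerDl.
- by move=> c _ [d ->]; exists (c * d); rewrite scalerA.
move=> w k wk.
have /eqP := perm_size wk; rewrite size_rcons eqSS => /eqP.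
have letter j : j \in rcons w k -> j = p \/ j = q.
  by rewrite (perm_mem wk) !inE => /or4P[]/eqP; [left|left|right|right].
case: w wk letter => [|x [|y [|z [|]]]] //= wk letter _.
(* Of the sixteen words of length four this count leaves six: two give vanishing brackets, four give
   the chosen one up to sign. *)
have {wk} : count_mem p [:: x; y; z; k] = 2.
  by rewrite (permP wk) /= eqxx (negPf qp).
have [] := letter x; rewrite ?mem_head // => ->.
all: have [] := letter y; rewrite ?inE ?eqxx ?orbT // => ->.
all: have [] := letter z; rewrite ?inE ?eqxx ?orbT // => ->.
all: have [] := letter k; rewrite ?inE ?eqxx ?orbT // => ->.
all: rewrite /= ?eqxx ?(negPf qp) //= => _.
- by exists 0; rewrite liexx !lie0r scale0r.
- by exists 1; rewrite scale1r.
- by exists (- 1); rewrite scaleN1r (lieC (bkm_e H q) (bkm_e H p)) !lieNr.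
- by exists 1; rewrite scale1r lie_pq_commute.
- exists (- 1).
  by rewrite scaleN1r (lieC (bkm_e H q) (bkm_e H p)) !lieNr lie_pq_commute.
- by exists 0; rewrite liexx !lie0r scale0r.
Qed.

End RootMultiplicities.

(** * Powers of a single [f_i] *)

Section Powers.
Variables (K : numFieldType) (n : nat) (A : 'M[K]_n) (H : realization A).
Variable V : lieModType (bkm H).

Lemma mulrn_lfunE (mu : 'Hom(cartan H, K^o)) m h :
  (mu *+ m) h = (mu h : K) *+ m.
Proof. by elim: m => [|m IHm]; rewrite ?lfunE // !mulrS add_lfunE IHm. Qed.

Lemma iter_f_weight mu i m (v : V) : weight_space mu v ->
  weight_space (mu - simple_root H i *+ m) (iter m (lact (bkm_f H i)) v).
Proof.
move=> vmu; elim: m => [|m IHm]; first by rewrite mulr0n subr0.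
by rewrite mulrSr opprD addrA; exact: weight_space_f.
Qed.

Lemma lact_e_iter_f mu i m (v : V) : weight_space mu v ->
  lact (bkm_e H i) v = 0 ->
  lact (bkm_e H i) (iter m.+1 (lact (bkm_f H i)) v) =
  (m.+1%:R * ((mu (simple_coroot H i) : K) - m%:R * A i i / 2))
    *: iter m (lact (bkm_f H i)) v.
Proof.
move=> vmu ev; have comm w : lact (bkm_e H i) (lact (bkm_f H i) w)
    = lact (bkm_h (simple_coroot H i)) w
      + lact (bkm_f H i) (lact (bkm_e H i) w).
  have := lact_lie (bkm_e H i) (bkm_f H i) w.
  by rewrite lie_ef eqxx => ->; rewrite subrK.
elim: m => [|m IHm].
  by rewrite /= comm ev lact0r addr0 vmu mul0r mul0r subr0 mul1r.
rewrite iterS comm IHm lactZr (iter_f_weight _ _ vmu) -scalerDl; congr (_ *: _).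
rewrite add_lfunE opp_lfunE mulrn_lfunE simple_root_coroot.
rewrite -[_ *+ _]mulr_natl -[m.+2]addn2 -addn1 !natrD.
by field.
Qed.

(** The numerical hypothesis makes the scalar in [lact_e_iter_f] vanish at exponent [m], and the
    other [e_j] commute with [f_i]. *)
Lemma maximal_iter_f mu i m (v : V) : weight_space mu v -> killed_by_nplus v ->
  2 * (mu (simple_coroot H i) : K) = A i i * (m%:R - 1) ->
  killed_by_nplus (iter m (lact (bkm_f H i)) v).
Proof.
move=> vmu /killed_by_nplusP vk mui; apply/killed_by_nplusP => j.
have [<-|ij] := eqVneq i j.
  case: m mui => [|m] mui; first exact: vk.
  rewrite (lact_e_iter_f _ vmu) //.
  have -> : (mu (simple_coroot H i) : K) = m%:R * A i i / 2.
    apply: (mulfI (_ : 2 != 0)); rewrite ?pnatr_eq0 // mui -addn1 natrD.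
    by field.
  by rewrite subrr mulr0 scale0r.
elim: m {mui} => [|m IHm]; first exact: vk.
have /= := lact_lie (bkm_e H j) (bkm_f H i) (iter m (lact (bkm_f H i)) v).
by rewrite lie_ef eq_sym (negPf ij) lact0l IHm lact0r subr0 => <-.
Qed.

End Powers.

(** * Maximal vectors *)

(** Serves to compute a space of maximal vectors, inside an infinite-dimensional module, as the
    kernel of a matrix. *)
Lemma has_dim_iso (K : fieldType) (U V : lmodType K) (P : U -> Prop)
    (Q : V -> Prop) (g : U -> V) d :
  (forall (c : K) x y, g (c *: x + y) = c *: g x + g y) ->
  P 0 -> (forall (c : K) x y, P x -> P y -> P (c *: x + y)) ->
  (forall x, P x -> Q (g x)) -> (forall x, P x -> g x = 0 -> x = 0) ->
  (forall y, Q y -> exists2 x, P x & g x = y) ->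
  has_dim Q d -> has_dim P d.
Proof.
move=> glin P0 PD PQ ginj gsurj [v [Qv indep span]].
have g0 : g 0 = 0.
  have := glin 1 0 0; rewrite !scale1r addr0 -[LHS]addr0 => /addrI.
  by [].
have gsum (c : 'I_d -> K) (F : 'I_d -> U) :
    g (\sum_i c i *: F i) = \sum_i c i *: g (F i).
  by elim/big_rec2: _ => // i y x _ <-; rewrite glin.
have /choice[F FP] i : exists x, P x /\ g x = v i.
  by have [x Px gx] := gsurj _ (Qv i); exists x.
have PF (c : 'I_d -> K) : P (\sum_i c i *: F i).
  by elim/big_rec: _ => // i x _ Px; apply: PD => //; have [] := FP i.
exists F; split=> [i|c c0|w Pw].
- by have [] := FP i.
- apply: indep; rewrite -[RHS]g0 -c0 gsum; apply: eq_bigr => i _.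
  by have [_ ->] := FP i.
have [c gw] := span _ (PQ _ Pw); exists c.
have Pzw := PD (-1) _ _ (PF c) Pw; apply/esym/eqP.
rewrite -subr_eq0 -oppr_eq0 opprB addrC -scaleN1r; apply/eqP/ginj => //.
rewrite glin gsum gw scaleN1r addrC; apply/eqP; rewrite subr_eq0; apply/eqP.
by apply: eq_bigr => i _; have [_ ->] := FP i.
Qed.

Lemma kermx_has_dim (F : fieldType) (r s : nat) (M : 'M[F]_(r, s)) :
  has_dim (fun u : 'rV_r => u *m M = 0) (r - \rank M).
Proof.
rewrite -mxrank_ker; set B := row_base (kermx M).
exists (fun i => row i B); split=> [i|c c0 i|w /sub_kermxP].
- by apply/sub_kermxP; rewrite -(eq_row_base (kermx M)); exact: row_sub.
- have : (\row_j c j) *m B = 0.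
    by rewrite mulmx_sum_row -[RHS]c0; apply: eq_bigr => j _; rewrite mxE.
  move/eqP; rewrite mulmx_free_eq0 ?row_base_free // => /eqP/rowP/(_ i).
  by rewrite !mxE.
rewrite -(eq_row_base (kermx M)) => /submxP[D ->]; exists (D 0).
exact: mulmx_sum_row.
Qed.

Section RecurrenceDim.
Variable K : fieldType.

Lemma recurrence_forward (m : nat) (x y : nat -> K) :
  (forall j, (j < m)%N -> x j != 0) ->
  exists g0 : nat -> K, [/\ exists2 j, (j <= m)%N & g0 j != 0,
    forall j, (j < m)%N -> x j * g0 j.+1 + y j * g0 j = 0
    & forall g, (forall j, (j < m)%N -> x j * g j.+1 + y j * g j = 0) ->
      exists c, forall j, (j <= m)%N -> g j = c * g0 j].
Proof.
move=> x0; pose g0 := fix g0 j := if j is i.+1 then - (y i / x i) * g0 i else 1.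
exists g0; split; first by exists 0%N; rewrite //= oner_eq0.
  by move=> j /x0 xj /=; field.
move=> g gP; exists (g 0%N); elim=> [|j IHj] jm; first by rewrite /= mulr1.
apply: (mulfI (x0 _ jm)); have /eqP := gP _ jm.
rewrite addr_eq0 => /eqP ->; rewrite IHj ?(ltnW jm) //=.
by have xj := x0 _ jm; field.
Qed.

(** Reversing the index, [j] to [m - j], exchanges the roles of [x] and [y]. *)
Lemma recurrence_backward (m : nat) (x y : nat -> K) :
  (forall j, (j < m)%N -> y j != 0) ->
  exists g0 : nat -> K, [/\ exists2 j, (j <= m)%N & g0 j != 0,
    forall j, (j < m)%N -> x j * g0 j.+1 + y j * g0 j = 0
    & forall g, (forall j, (j < m)%N -> x j * g j.+1 + y j * g j = 0) ->
      exists c, forall j, (j <= m)%N -> g j = c * g0 j].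
Proof.
move=> y0.
have [|g0 [[j jm g0j] g0P g0U]] := @recurrence_forward m
    (fun j => y (m - j.+1)%N) (fun j => x (m - j.+1)%N).
  by move=> j jm; apply: y0; lia.
exists (fun j => g0 (m - j)%N); split.
- by exists (m - j)%N; rewrite ?leq_subr ?subKn.
- move=> i im; have /= := g0P (m - i.+1)%N.
  by rewrite subnSK // subKn ?(ltnW im) // addrC; apply; lia.
- move=> g gP; have [i im|c cP] := g0U (fun j => g (m - j)%N).
    by have := gP (m - i.+1)%N; rewrite subnSK // addrC; apply; lia.
  by exists c => i im; rewrite -cP ?leq_subr // subKn.
Qed.

End RecurrenceDim.

Section MaximalVectors.
Variables (K : numFieldType) (n : nat) (A : 'M[K]_n) (H : realization A).
Variables (sf : serre_free A) (lam : 'Hom(cartan H, K^o)).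

Lemma maximal_space0 (V : lieModType (bkm H)) mu :
  maximal_space (V := V) mu 0.
Proof. by split=> [h|x _]; rewrite lact0r ?scaler0. Qed.

Lemma maximal_space_lin (V : lieModType (bkm H)) mu (c : K) (v w : V) :
  maximal_space mu v -> maximal_space mu w -> maximal_space mu (c *: v + w).
Proof.
move=> [vmu vk] [wmu wk]; split=> [h|x nx]; rewrite lactDr lactZr.
  by rewrite vmu wmu scalerDr !scalerA mulrC.
by rewrite vk // wk // scaler0 addr0.
Qed.

Lemma weight_space_killed (v : verma lam) : weight_space lam v ->
  killed_by_nplus v.
Proof.
move=> vw; have vw' : weight_space (lam - word_wt H [::]) v.
  by rewrite /word_wt big_nil subr0.
by apply/(killed_by_nplus_coord sf vw') => i u /perm_size.
Qed.

Lemma word_coef_coroot i u : word_coef lam (simple_coroot H i) u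
  = lam (simple_coroot H i) - \sum_(j <- u) A i j.
Proof.
elim: u => [|j u IHu]; first by rewrite /word_coef /word_wt !big_nil lfunE.
by rewrite word_coef_cons IHu simple_root_coroot big_cons opprD addrCA addrC.
Qed.

(** * The weight [lam - alpha_p - m alpha_q] *)

Section TwoLetters.
Variables p q : 'I_n.

Definition one_p_word i j : seq 'I_n := nseq i q ++ p :: nseq j q.

Lemma perm_one_p_word m u : perm_eq u (p :: nseq m q) <->
  exists2 j, (j <= m)%N & u = one_p_word (m - j) j.
Proof.
split=> [um|[j jm ->]]; last first.
  rewrite /one_p_word perm_catC /= perm_cons -nseqD.
  by rewrite (_ : j + (m - j) = m)%N //; lia.
have pu : p \in u by rewrite (perm_mem um) mem_head.
case/splitPr: pu um => u1 u2.
rewrite (perm_catCA u1 [:: p] u2) perm_cons => um.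
have szu := perm_size um; rewrite size_cat size_nseq in szu.
have : all (pred1 q) (u1 ++ u2) by rewrite (perm_all _ um) all_pred1_nseq.
rewrite all_cat => /andP[/all_pred1P u1E /all_pred1P u2E].
exists (size u2); first by lia.
by rewrite u1E u2E !size_nseq /one_p_word; congr (nseq _ _ ++ _); lia.
Qed.

Hypothesis pq : p != q.

Lemma index_one_p_word i j : index p (one_p_word i j) = i.
Proof.
by rewrite index_cat mem_nseq (negPf pq) andbF size_nseq /= eqxx addn0.
Qed.

Let lp : K := lam (simple_coroot H p).
Let lq : K := lam (simple_coroot H q).

Lemma word_coef_nseq i j : word_coef lam (simple_coroot H i) (nseq j q)
  = (lam (simple_coroot H i) : K) - j%:R * A i q.
Proof.
by rewrite word_coef_coroot big_nseq iter_addr addr0 mulr_natl.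
Qed.

Lemma word_e_nseq j (G : word_fun K n) : word_e lam q (nseq j q) G
  = j.+1%:R * (lq - j%:R * A q q / 2) * G (nseq j.+1 q).
Proof.
elim: j G => [|j IHj] G.
  rewrite /= -[[::]]/(nseq 0 q) word_coef_nseq -/lq.
  by field.
rewrite -[LHS]/(word_coef lam (simple_coroot H q) (nseq j.+1 q) * G (nseq j.+2
  q)
  + word_e lam q (nseq j q) (fun x => G (q :: x))) IHj word_coef_nseq -/lq.
rewrite -[q :: nseq j.+1 q]/(nseq j.+2 q) -!natr1.
by field.
Qed.

(** The letter [q] can be inserted at [j.+1] places after [p] and at [i.+1] places before it; in
    both groups the coefficients form an arithmetic progression of step [- A q q]. *)
Lemma word_e_one_p_word i j (G : word_fun K n) : word_e lam q (one_p_word i j) G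
  = j.+1%:R * (lq - j%:R * A q q / 2) * G (one_p_word i j.+1)
  + i.+1%:R * (lq - j%:R * A q q - A q p - i%:R * A q q / 2)
    * G (one_p_word i.+1 j).
Proof.
elim: i G => [|i IHi] G.
  rewrite -[LHS]/(word_coef lam (simple_coroot H q) (p :: nseq j q)
    * G (q :: p :: nseq j q) + word_e lam q (nseq j q) (fun x => G (p :: x))).
  rewrite word_e_nseq word_coef_cons word_coef_nseq simple_root_coroot -/lq.
  by rewrite /one_p_word /=; field.
rewrite -[LHS]/(word_coef lam (simple_coroot H q) (q :: one_p_word i j)
  * G (q :: q :: one_p_word i j)
  + word_e lam q (one_p_word i j) (fun x => G (q :: x))) IHi.
have -> : word_coef lam (simple_coroot H q) (q :: one_p_word i j)
    = lq - (i.+1 + j)%:R * A q q - A q p.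
  rewrite word_coef_coroot big_cons big_cat big_cons !big_nseq !iter_addr
    !addr0.
  by rewrite -!(mulr_natl (A q q)) natrD -!natr1 /lq /=; ring.
rewrite -[q :: q :: _]/(one_p_word i.+2 j) -[q :: one_p_word i
  j.+1]/(one_p_word i.+1 j.+1).
rewrite natrD -!natr1.
by field.
Qed.

Lemma word_e_p_nseq m (G : word_fun K n) : word_e lam p (nseq m q) G
  = \sum_(j < m.+1) (lp - j%:R * A p q) * G (one_p_word (m - j) j).
Proof.
elim: m G => [|m IHm] G.
  by rewrite big_ord1 /= -[[::]]/(nseq 0 q) word_coef_nseq addr0.
rewrite -[LHS]/(word_coef lam (simple_coroot H p) (nseq m.+1 q) * G (p :: nseq
  m.+1 q)
  + word_e lam p (nseq m q) (fun x => G (q :: x))) IHm word_coef_nseq -/lp.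
rewrite [RHS]big_ord_recr /= subnn addrC; congr (_ + _); apply: eq_bigr => j _.
by rewrite subSn // -ltnS.
Qed.

Hypothesis Aqp : A q p = A p q.

(* The last disjunction says that the two-term recurrence [e_q w = 0] on the
   coordinates of [w] can be solved forwards or backwards. *)
Lemma maximal_space_1n m :
  lp + m%:R * lq = A q q / 2 * m%:R * (m%:R - 1) + m%:R * A p q ->
  (forall j, (j < m)%N -> lq - j%:R * A q q / 2 != 0)
  \/ (forall j, (j < m)%N ->
      lq - j%:R * A q q - A p q - (m%:R - 1 - j%:R) * A q q / 2 != 0) ->
  has_dim (maximal_space (V := verma lam) (lam - word_wt H (p :: nseq m q))) 1.
Proof.
move=> norm_eq nz.
pose x j : K := j.+1%:R * (lq - j%:R * A q q / 2).
pose y j : K := (m%:R - j%:R)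
  * (lq - j%:R * A q q - A p q - (m%:R - 1 - j%:R) * A q q / 2).
pose rec (g : nat -> K) := forall j, (j < m)%N -> x j * g j.+1 + y j * g j = 0.
have [g0 [[j0 j0m g0j0] g0P g0U]] : exists g0 : nat -> K,
    [/\ exists2 j, (j <= m)%N & g0 j != 0, rec g0
    & forall g, rec g -> exists c, forall j, (j <= m)%N -> g j = c * g0 j].
  case: nz => nz; [apply: recurrence_forward | apply: recurrence_backward].
    by move=> j jm; rewrite mulf_neq0 ?pnatr_eq0 ?nz.
  move=> j jm; rewrite mulf_neq0 ?nz // -natrB ?pnatr_eq0 ?(ltnW jm) //.
  by rewrite -lt0n subn_gt0.
have killedP (G : word_fun K n) (g := fun j => G (one_p_word (m - j) j) : K) :
    (forall i u, perm_eq (i :: u) (p :: nseq m q) -> word_e lam i u G = 0)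
    <-> rec g.
  have word_e_rec j : (j < m)%N ->
      word_e lam q (one_p_word (m - j.+1) j) G = x j * g j.+1 + y j * g j.
    move=> jm; rewrite word_e_one_p_word subnSK // /x /y /g Aqp.
    congr (_ + _ * _ * _); first by rewrite natrB // ltnW.
    by congr (_ - _ * _ / _); rewrite natrB // -natr1 opprD addrA addrAC.
  split=> [Ge j jm|grec].
    rewrite -word_e_rec //; apply: Ge.
    apply/perm_one_p_word; exists j; first exact: ltnW.
    by rewrite -(subnSK jm).
  move=> i u iu; have := perm_mem iu i.
  rewrite mem_head inE => /esym/orP[/eqP ip|/nseqP[iq m0]].
    rewrite ip perm_cons in iu *.
    have -> : u = nseq m q.
      rewrite -(size_nseq m q) -(perm_size iu); apply/all_pred1P.
      by rewrite (perm_all _ iu) all_pred1_nseq.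
    rewrite word_e_p_nseq.
    (* [x'] is [x] shifted by one index, with [x' 0 = 0], and [y m = 0]. By [norm_eq] the
       coefficient of [g j] in the [e_p] equation is [- (x' j + y j)], so that equation is minus the
       sum of the recurrence equations. *)
    pose x' j : K := j%:R * (lq - (j%:R - 1) * A q q / 2).
    have -> : \sum_(j < m.+1) (lp - j%:R * A p q) * G (one_p_word (m - j) j)
        = - (\sum_(j < m.+1) x' j * g j + \sum_(j < m.+1) y j * g j).
      rewrite -big_split -sumrN; apply: eq_bigr => j _ /=.
      have -> : lp - j%:R * A p q = - (x' j + y j).
        by rewrite -[lp](addrK (m%:R * lq)) norm_eq /x' /y; field.
      by rewrite mulNr mulrDl.
    rewrite big_ord_recl {1}/x' !mul0r add0r big_ord_recr /= {2}/y subrr !mul0r.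
    rewrite addr0 -big_split big1 ?oppr0 // => j _ /=.
    rewrite -[RHS](grec j) //; congr (_ * _ + _).
    by rewrite /x' /x /bump add1n -natr1 addrK.
  have : exists2 j, (j < m)%N & u = one_p_word (m - j.+1) j.
    have [j jm iuE] := (perm_one_p_word m (i :: u)).1 iu.
    (* For [j = m] the word [i :: u] would start with [p], not with [q]. *)
    have jm' : (j < m)%N.
      rewrite ltn_neqAle jm andbT; apply: contra pq => /eqP jm'.
      by move: iuE; rewrite jm' subnn => -[<- _]; rewrite iq.
    exists j => //; move: iuE; rewrite -(subnSK jm') iq.
    by move=> -[].
  by move=> [j jm ->]; rewrite iq word_e_rec //; exact: grec.
(* [index p u] counts the letters before [p], so [m - index p u] counts those after it, which is the
   parameter of [g0]. *)
have [v vE] := word_coord_surj sf lam (w0 := p :: nseq m q)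
  (G := fun u => if perm_eq u (p :: nseq m q) then g0 (m - index p u)%N else 0)
  (fun u => ifN _ _).
have vg0 j : (j <= m)%N -> word_coord sf v (one_p_word (m - j) j) = g0 j.
  move=> jm; rewrite vE index_one_p_word subKn // ifT //.
  by apply/perm_one_p_word; exists j.
have vw : weight_space (lam - word_wt H (p :: nseq m q)) v.
  by apply/(weight_space_coord sf) => u /negPf uw; rewrite vE uw.
apply: (has_dim1 (v := v)).
- split=> //; apply/(killed_by_nplus_coord sf vw)/killedP => j jm.
  by rewrite !vg0 ?g0P // ltnW.
- by apply: contraNneq g0j0 => v0; rewrite -vg0 // v0 word_coord0.
move=> w [ww wk]; have /killedP wrec := (killed_by_nplus_coord sf ww).1 wk.
have [c cP] := g0U _ wrec; exists c; apply: (word_coord_inj (sf := sf)) => u.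
rewrite word_coordZ; have [um|um] := boolP (perm_eq u (p :: nseq m q)).
  by have [j jm ->] := (perm_one_p_word m u).1 um; rewrite vg0 // -cP.
by rewrite ((weight_space_coord sf _ _).1 ww) // vE (negPf um) mulr0.
Qed.

End TwoLetters.

Lemma perm_one_two (p q : 'I_n) u : perm_eq u [:: p; q; q] ->
  [\/ u = [:: p; q; q], u = [:: q; p; q] | u = [:: q; q; p]].
Proof.
move=> /(perm_one_p_word p q 2)[[|[|[|]]] // _ ->].
- exact: Or33.
- exact: Or32.
- exact: Or31.
Qed.

(** * The weight [lam - 2 alpha_p - 2 alpha_q] *)

Section WordE22.
Variables (p q : 'I_n) (k t x y : K).
Hypotheses (App : A p p = 2 * k) (Apq : A p q = t * k).
Hypotheses (lamp : (lam (simple_coroot H p) : K) = x * k).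
Hypothesis tE : 2 * t = x + y - 2.
Variable G : word_fun K n.

Let tE' : t = (x + y - 2) / 2.
Proof. by rewrite -tE; field. Qed.

(** In the application [k = - b / 2], [t = 2 a / b], [x = M_p - 1] and [y = M_q - 1], and [tE] is
    [star] at (2, 2). It serves to eliminate [t], which leaves coefficients in [x] and [y] alone. *)
Lemma word_e_pqq : word_e lam p [:: p; q; q] G =
  k * (- (2 * y - 2) * G [:: p; p; q; q] + (x - y + 2) / 2 * G [:: p; q; p; q]
    + x * G [:: p; q; q; p]).
Proof.
rewrite /= !word_coef_coroot !big_cons !big_nil App Apq lamp tE'.
by field.
Qed.

Lemma word_e_qpq : word_e lam p [:: q; p; q] G =
  k * (- y * G [:: p; q; p; q] + (x - y) * G [:: q; p; p; q]
    + x * G [:: q; p; q; p]).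
Proof.
rewrite /= !word_coef_coroot !big_cons !big_nil App Apq lamp tE'.
by field.
Qed.

Lemma word_e_qqp : word_e lam p [:: q; q; p] G =
  k * (- y * G [:: p; q; q; p] + (x - y - 2) / 2 * G [:: q; p; q; p]
    + (2 * x - 2) * G [:: q; q; p; p]).
Proof.
rewrite /= !word_coef_coroot !big_cons !big_nil App Apq lamp tE'.
by field.
Qed.

End WordE22.

Section Matrix22.
Variables x y : nat.

(* The columns are [word_e_pqq], [word_e_qpq] and [word_e_qqp] once the
   coordinates at [qppq] and [pqqp] are identified. *)
Definition mx22 : 'M[K]_(5, 3) := \matrix_(i < 5, j < 3)
  (nth [::] [:: [:: - (2 * y%:R - 2); 0; 0];
                [:: (x%:R - y%:R + 2) / 2; - y%:R; 0];
                [:: x%:R; x%:R - y%:R; - y%:R];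
                [:: 0; x%:R; (x%:R - y%:R - 2) / 2];
                [:: 0; 0; 2 * x%:R - 2]] i)`_j.

Definition row5 (a b c e f : K) : 'rV[K]_5 :=
  \row_(j < 5) [:: a; b; c; e; f]`_j.

Lemma row5_surj (u : 'rV[K]_5) : exists a b c e f, u = row5 a b c e f.
Proof.
exists (u 0 (inord 0)), (u 0 (inord 1)), (u 0 (inord 2)), (u 0 (inord 3)).
exists (u 0 (inord 4)); apply/rowP => j; rewrite mxE.
have {1}-> : j = inord j by rewrite inord_val.
by case: j => -[|[|[|[|[|]]]]].
Qed.

Lemma row5_mx22 a b c e f : row5 a b c e f *m mx22 = 0 <->
  [/\ - (2 * y%:R - 2) * a + (x%:R - y%:R + 2) / 2 * b + x%:R * c = 0,
      - y%:R * b + (x%:R - y%:R) * c + x%:R * e = 0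
    & - y%:R * c + (x%:R - y%:R - 2) / 2 * e + (2 * x%:R - 2) * f = 0].
Proof.
split=> [/rowP E|[E1 E2 E3]].
  have := E 0; have := E 1; have := E 2.
  rewrite !mxE !big_ord_recl !big_ord0 !mxE /= => E3 E2 E1; split.
  - by rewrite -[RHS]E1; ring.
  - by rewrite -[RHS]E2; ring.
  - by rewrite -[RHS]E3; ring.
apply/rowP => -[[|[|[|]]] lt] //; rewrite !mxE !big_ord_recl !big_ord0 !mxE /=.
- by rewrite -[RHS]E1; ring.
- by rewrite -[RHS]E2; ring.
- by rewrite -[RHS]E3; ring.
Qed.

(** The first row vanishes when [y = 1] and the last one when [x = 1]; the bound excludes that both
    happen, where the rank would be 2. Otherwise back substitution starts from a nonzero outer
    row. *)
Lemma rank_mx22 : (2 < x + y)%N -> \rank mx22 = 3.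
Proof.
move=> xy; rewrite -mxrank_tr; apply/eqP; rewrite -/(row_free _).
apply: inj_row_free => v /rowP E.
pose r := v 0 0; pose s := v 0 1; pose u := v 0 2.
have vE : v = \row_j [:: r; s; u]`_j.
  by apply/rowP => -[[|[|[|]]] lt] //; rewrite mxE /=; congr (v 0 _);
    apply: val_inj.
move: E; rewrite {1}vE => E; move: (E 0) (E 1) (E 2) (E 3) (E 4).
rewrite !mxE !big_ord_recl !big_ord0 !mxE /=.
rewrite !(mulr0, addr0, add0r) => E0 E1 E2 E3 E4.
have natB1 z : (2 * z%:R - 2 == 0 :> K) = (z == 1%N).
  by rewrite subr_eq0 -natrM eqr_nat; lia.
have zero z w : z * w = 0 -> w != 0 -> z = 0 :> K.
  by move=> /eqP; rewrite mulf_eq0 => /orP[/eqP->|/eqP->] //; rewrite eqxx.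
have [y1|y1] := eqVneq y 1%N.
  have x0 : x%:R != 0 :> K by rewrite pnatr_eq0; lia.
  have u0 : u = 0 by apply: zero E4 _; rewrite natB1; lia.
  have s0 : s = 0 by move: E3; rewrite u0 mul0r addr0 => /zero; exact.
  have r0 : r = 0 by move: E2; rewrite u0 s0 !mul0r !addr0 => /zero; exact.
  by rewrite vE r0 s0 u0; apply/rowP => -[[|[|[|]]] lt] //; rewrite !mxE.
have r0 : r = 0 by apply: zero E0 _; rewrite oppr_eq0 natB1.
move: E1 E2; rewrite r0 !mul0r !add0r => E1 E2.
have [x1|x1] := eqVneq x 1%N.
  have y0 : - y%:R != 0 :> K by rewrite oppr_eq0 pnatr_eq0; lia.
  have s0 : s = 0 by exact: zero E1 y0.
  have u0 : u = 0 by move: E2; rewrite s0 mul0r add0r => /zero; exact.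
  by rewrite vE r0 s0 u0; apply/rowP => -[[|[|[|]]] lt] //; rewrite !mxE.
have u0 : u = 0 by apply: zero E4 _; rewrite natB1.
move: E3; rewrite u0 mul0r addr0 => E3.
have s0 : s = 0.
  have [x0|x0] := eqVneq x 0%N.
    by apply: zero E1 _; rewrite oppr_eq0 pnatr_eq0; lia.
  by apply: zero E3 _; rewrite pnatr_eq0.
by rewrite vE r0 s0 u0; apply/rowP => -[[|[|[|]]] lt] //; rewrite !mxE.
Qed.

End Matrix22.

Lemma maximal_space_22 (p q : 'I_n) (k t : K) (x y : nat) : p != q -> k != 0 ->
  A p p = 2 * k -> A q q = 2 * k -> A p q = t * k -> A q p = t * k ->
  (lam (simple_coroot H p) : K) = x%:R * k ->
  (lam (simple_coroot H q) : K) = y%:R * k ->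
  2 * t = x%:R + y%:R - 2 -> (2 < x + y)%N ->
  has_dim (maximal_space (V := verma lam) (lam - word_wt H [:: p; p; q; q])) 2.
Proof.
move=> pq k0 App Aqq Apq Aqp lamp lamq tE xy.
have qp : q != p by rewrite eq_sym.
have tE' : 2 * t = y%:R + x%:R - 2 by rewrite tE addrC [_%:R + _]addrC addrC.
have killedP (G : word_fun K n) :
    (forall i u, perm_eq (i :: u) [:: p; p; q; q] -> word_e lam i u G = 0) <->
    G [:: q; p; p; q] = G [:: p; q; q; p] /\
    row5 (G [:: p; p; q; q]) (G [:: p; q; p; q]) (G [:: p; q; q; p])
      (G [:: q; p; q; p]) (G [:: q; q; p; p]) *m mx22 x y = 0.
  have wp := (word_e_pqq App Apq lamp tE G, word_e_qpq App Apq lamp tE G,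
    word_e_qqp App Apq lamp tE G).
  have wq := (word_e_pqq Aqq Aqp lamq tE' G, word_e_qpq Aqq Aqp lamq tE' G,
    word_e_qqp Aqq Aqp lamq tE' G).
  have kz (z : K) : k * z = 0 -> z = 0 by move/eqP;
    rewrite mulf_eq0 (negPf k0) => /eqP.
  split=> [Ge|[DC /row5_mx22[E1 E2 E3]]].
    have [E1 E2 E3] : [/\ word_e lam p [:: p; q; q] G = 0,
        word_e lam p [:: q; p; q] G = 0 & word_e lam p [:: q; q; p] G = 0].
      by split; apply: Ge; apply/permP => a /=; lia.
    have [F1 F2 F3] : [/\ word_e lam q [:: q; p; p] G = 0,
        word_e lam q [:: p; q; p] G = 0 & word_e lam q [:: p; p; q] G = 0].
      by split; apply: Ge; apply/permP => a /=; lia.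
    move: E1 E2 E3 F1 F2 F3;
      rewrite !wp !wq => /kz E1 /kz E2 /kz E3 /kz F1 /kz F2 /kz F3.
    have DC : G [:: q; p; p; q] = G [:: p; q; q; p].
      (* The [e_p] equation at [pqq] and the [e_q] equation at [ppq] add up to this; the pair [qqp],
         [qpp] gives the same with factor [y]. Not both factors vanish. *)
      have xDC : x%:R * (G [:: p; q; q; p] - G [:: q; p; p; q]) = 0 :> K.
        by rewrite -[RHS]addr0 -{1}E1 -F3; field.
      have yDC : y%:R * (G [:: q; p; p; q] - G [:: p; q; q; p]) = 0 :> K.
        by rewrite -[RHS]addr0 -{1}E3 -F1; field.
      have [x0|x0] := eqVneq x 0%N.
        have y0 : y%:R != 0 :> K by rewrite pnatr_eq0; lia.
        by move/eqP: yDC; rewrite mulf_eq0 (negPf y0) subr_eq0 => /eqP.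
      move/eqP: xDC; rewrite mulf_eq0 pnatr_eq0 (negPf x0) subr_eq0 => /eqP.
      by [].
    by split=> //; apply/row5_mx22; split; rewrite -?DC // DC.
  have zk (z : K) : z = 0 -> k * z = 0 by move=> ->; rewrite mulr0.
  move=> i u iu; have := perm_mem iu i.
  rewrite mem_head !inE => /esym iE.
  have {iE} [ip|iq] : i = p \/ i = q by case/or4P: iE => /eqP; auto.
    rewrite ip in iu *; have : perm_eq u [:: p; q;
      q] by rewrite perm_cons in iu.
    by case/perm_one_two => ->; rewrite wp ?DC; apply: zk.
  rewrite iq in iu *; have : perm_eq u [:: q; p; p].
    by apply/permP => a; have := permP iu a => /=; lia.
  (* Once the two coordinates agree, the [e_q] equations are the negatives of the [e_p] equations in
     reverse order. *)
  case/perm_one_two => ->; rewrite wq ?DC; apply: zk.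
  - by rewrite -[RHS]oppr0 -E3; field.
  - by rewrite -[RHS]oppr0 -E2; field.
  - by rewrite -[RHS]oppr0 -E1; field.
have perm22 u : perm_eq u [:: p; p; q; q] -> u \in [:: [:: p; p; q; q];
    [:: p; q; p; q]; [:: p; q; q; p]; [:: q; p; p; q]; [:: q; p; q; p];
    [:: q; q; p; p]].
  case: u => [/perm_size //|i u] iu; have := perm_mem iu i.
  rewrite mem_head !inE => /esym iE.
  have {iE} [ip|iq] : i = p \/ i = q by case/or4P: iE => /eqP; auto.
    rewrite ip perm_cons in iu *.
    by case/perm_one_two: iu => ->; rewrite !eqxx ?orbT.
  rewrite iq in iu *; have : perm_eq u [:: q; p; p].
    by apply/permP => a; have := permP iu a => /=; lia.
  by case/perm_one_two => ->; rewrite !eqxx ?orbT.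
pose g (v : verma lam) := let G := word_coord sf v in
  row5 (G [:: p; p; q; q]) (G [:: p; q; p; q]) (G [:: p; q; q; p])
    (G [:: q; p; q; p]) (G [:: q; q; p; p]).
have -> : 2%N = (5 - \rank (mx22 x y))%N by rewrite rank_mx22.
apply: (has_dim_iso (g := g)) (kermx_has_dim (mx22 x y)).
- move=> c v w; apply/rowP => -[[|[|[|[|[|]]]]] lt] //;
    by rewrite !mxE /= word_coordD word_coordZ.
- exact: maximal_space0.
- by move=> c v w; exact: maximal_space_lin.
- move=> v [vw vk].
  by have /killedP[] := (killed_by_nplus_coord sf vw).1 vk.
- move=> v [vw vk] /rowP gv.
  have /killedP[DC _] := (killed_by_nplus_coord sf vw).1 vk.
  apply: (word_coord_eq0 (sf := sf)) => u.
  have [/perm22|um] := boolP (perm_eq u [:: p; p; q; q]); last first.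
    exact: (weight_space_coord sf _ _).1 vw _ um.
  move: (gv 0) (gv 1) (gv 2) (gv 3) (gv 4); rewrite !mxE /= => va vb vc ve vf.
  rewrite !inE => /or4P[/eqP-> //|/eqP-> //|/eqP-> //|/or3P[]/eqP->] //.
  by rewrite DC.
move=> u uM; have [a [b [c [e [f uE]]]]] := row5_surj u.
pose words := [:: [:: p; p; q; q]; [:: p; q; p; q]; [:: p; q; q; p];
  [:: q; p; p; q]; [:: q; p; q; p]; [:: q; q; p; p]].
(* [c] stands at both [pqqp] and [qppq]; a word outside the list has index 6 and gets the default
   0. *)
pose G : word_fun K n := fun w => [:: a; b; c; c; e; f]`_(index w words).
have [|v vG] := word_coord_surj sf lam (w0 := [:: p; p; q; q]) (G := G).
  move=> w; rewrite /G => wm; rewrite nth_default // leqNgt index_mem.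
  apply: contra wm; rewrite !inE => /or4P[/eqP->|/eqP->|/eqP->|/or3P[]/eqP->];
    by apply/permP => z /=; lia.
have gv : g v = u.
  rewrite uE /g !vG /G /words /= !eqseq_cons !eqxx (negPf pq) (negPf qp) /=.
  by [].
exists v => //; have vw : weight_space (lam - word_wt H [:: p; p; q; q]) v.
  apply/(weight_space_coord sf) => w wm; rewrite vG /G nth_default //.
  rewrite leqNgt index_mem; apply: contra wm.
  rewrite !inE => /or4P[/eqP->|/eqP->|/eqP->|/or3P[]/eqP->];
    by apply/permP => z /=; lia.
split=> //; apply/(killed_by_nplus_coord sf vw)/killedP; split.
  by rewrite !vG /G /words /= !eqseq_cons !eqxx (negPf pq) (negPf qp).
by rewrite -/(g v) gv.
Qed.

End MaximalVectors.

(** * The matrix with diagonal [-b] and off-diagonal [-a] *)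

Section BKMMatrix.
Variables (R : realType) (a b : nat) (ha : (0 < a)%N) (hb : (0 < b)%N).
Let A := bkm_matrix R a b.

Lemma bkm_matrix_diag i : A i i = - b%:R.
Proof. by rewrite mxE eqxx. Qed.

Lemma bkm_matrix_off i j : i != j -> A i j = - a%:R.
Proof. by rewrite mxE => /negPf ->. Qed.

Lemma bkm_matrix_serre_free : serre_free A.
Proof.
split=> [i|i j]; first by rewrite mxE eqxx oppr_gt0 ltrn0.
by rewrite mxE; case: (i == j); rewrite oppr_eq0 pnatr_eq0 -lt0n.
Qed.

(** Without denominators and subtractions the equation becomes usable by [nia]. *)
Lemma star_nat M1 M2 X Y : star a b M1 M2 X Y ->
  (b * (X * X + Y * Y) + 2 * a * X * Y = b * (M1 * X + M2 * Y))%N.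
Proof.
move=> E; have b0 : b%:R != 0 :> rat by rewrite pnatr_eq0 -lt0n.
apply/eqP; rewrite -(eqr_nat rat) -subr_eq0 !(natrD, natrM); apply/eqP.
transitivity (b%:R * 0 : rat); last exact: mulr0.
rewrite -[X in _ = _ * X]E.
by field.
Qed.

Variables (H : realization A) (lam : 'Hom(cartan H, R[i]^o)).

Lemma Ppm_coroot (Mi : nat) i : Ppm lam ->
  Mi%:R = 2 / A i i * lam (simple_coroot H i) + 1 ->
  (0 < Mi)%N /\ (lam (simple_coroot H i) : R[i]) = (Mi.-1)%:R * - (b%:R / 2).
Proof.
move=> /(_ i)[k lamk]; rewrite lamk => MiE.
have b0 : b%:R != 0 :> R[i] by rewrite pnatr_eq0 -lt0n.
have : Mi = k.+1.
  apply/eqP; rewrite -(eqr_nat R[i]) MiE bkm_matrix_diag -natr1; apply/eqP.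
  by field.
by move=> -> /=; split=> //; rewrite bkm_matrix_diag; ring.
Qed.

Lemma verma_dim_1n p q Mp Mq m : p != q -> (0 < Mp)%N -> (0 < Mq)%N ->
  (lam (simple_coroot H p) : R[i]) = (Mp.-1)%:R * - (b%:R / 2) ->
  (lam (simple_coroot H q) : R[i]) = (Mq.-1)%:R * - (b%:R / 2) ->
  (b * (1 + m * m) + 2 * a * m = b * (Mp + Mq * m))%N ->
  has_dim (maximal_space (V := verma lam) (lam - word_wt H (p :: nseq m q))) 1.
Proof.
case: Mp => // x; case: Mq => // y pq _ _ /= lamp lamq normE.
have qp : q != p by rewrite eq_sym.
apply: (maximal_space_1n bkm_matrix_serre_free pq); rewrite ?lamp ?lamq.
- by rewrite !bkm_matrix_off.
- rewrite bkm_matrix_diag bkm_matrix_off //.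
  have : (b * (m * m) + 2 * a * m = b * (x + y * m + m))%N by nia.
  move/(congr1 (fun z => z%:R : R[i])); rewrite !(natrD, natrM) => E.
  apply: (mulfI (_ : -2 != 0)); first by rewrite oppr_eq0 pnatr_eq0.
  apply/eqP; rewrite -subr_eq0; apply/eqP.
  move/eqP: E; rewrite -subr_eq0 => /eqP E.
  by rewrite -[RHS]oppr0 -E; field.
have half (u v : nat) : u != v -> - (u%:R - v%:R) / 2 != 0 :> R[i].
  by move=> uv; rewrite mulf_neq0 ?invr_eq0 ?pnatr_eq0 // oppr_eq0 subr_eq0
    eqr_nat.
rewrite bkm_matrix_diag bkm_matrix_off //.
(* The norm equation reads [b m^2 + 2 a m = b x + b (y + 1) m]. For [x = 0] and [m > 0] it forces
   [y >= m], so [y - j] is nonzero. For [x > 0] a zero of the other sequence,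
   [b (y + 1) = b (m + j) + 2 a], would give [b x + b m j = 0]. *)
have [x0|x0] := posnP x; [left | right] => j jm.
  have -> : y%:R * - (b%:R / 2) - j%:R * - b%:R / 2
      = - ((b * y)%:R - (b * j)%:R) / 2 :> R[i] by rewrite !natrM; field.
  apply: half; rewrite eqn_pmul2l //; apply: contraTneq jm => yj; nia.
have -> : y%:R * - (b%:R / 2) - j%:R * - b%:R - - a%:R
      - (m%:R - 1 - j%:R) * - b%:R / 2
    = - ((b * y.+1)%:R - (b * (m + j) + 2 * a)%:R) / 2 :> R[i].
  by rewrite !(natrD, natrM) -natr1; field.
apply: half; apply/negP => /eqP E.
have : (b * y.+1 * m = (b * (m + j) + 2 * a) * m)%N by rewrite E.
nia.
Qed.

Lemma verma_dim_22 M1 M2 : (0 < M1)%N -> (0 < M2)%N ->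
  (lam (simple_coroot H 0) : R[i]) = (M1.-1)%:R * - (b%:R / 2) ->
  (lam (simple_coroot H 1) : R[i]) = (M2.-1)%:R * - (b%:R / 2) ->
  (b * (2 * 2 + 2 * 2) + 2 * a * 2 * 2 = b * (M1 * 2 + M2 * 2))%N ->
  has_dim (maximal_space (V := verma lam) (lam - word_wt H [:: 0; 0; 1; 1])) 2.
Proof.
case: M1 => // x; case: M2 => // y _ _ /= lamp lamq normE.
have b0 : b%:R != 0 :> R[i] by rewrite pnatr_eq0 -lt0n.
apply: (maximal_space_22 bkm_matrix_serre_free (k := - (b%:R / 2))
  (t := 2 * a%:R / b%:R)) lamp lamq _ _ => //.
- by rewrite oppr_eq0 mulf_neq0 // invr_eq0 pnatr_eq0.
- by rewrite bkm_matrix_diag; field.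
- by rewrite bkm_matrix_diag; field.
- by rewrite bkm_matrix_off //; field.
- by rewrite bkm_matrix_off //; field.
- have : (2 * (2 * a) + 2 * b = b * (x + y))%N by nia.
  move/(congr1 (fun z => z%:R : R[i])); rewrite !(natrD, natrM) => E.
  apply: (mulfI b0); rewrite mulrBr -E.
  by field.
by nia.
Qed.

End BKMMatrix.

Theorem proposition3p7 (R : realType) (a b : nat) (ha : (0 < a)%N)
    (hb : (0 < b)%N) (H : realization (bkm_matrix R a b))
    (lam : 'Hom(cartan H, R[i]^o)) (hlam : Ppm lam) (M1 M2 : nat)
    (hM1 : M1%:R = 2 / bkm_matrix R a b 0 0 * lam (simple_coroot H 0) + 1)
    (hM2 : M2%:R = 2 / bkm_matrix R a b 1 1 * lam (simple_coroot H 1) + 1) :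
  let wt (X Y : nat) : 'Hom(cartan H, R[i]^o) :=
    simple_root H 0 *+ X + simple_root H 1 *+ Y in
  [/\ (* (a) *)
      forall n : nat, n%:R = M2%:R - 2 * a%:R / b%:R * M1%:R :> rat ->
        star a b M1 M2 M1 n ->
        forall v : verma lam, weight_space lam v ->
        let w := iter n (lact (bkm_f H 1)) (iter M1 (lact (bkm_f H 0)) v) in
        w != 0 -> maximal_vector w,
      (* (b) *)
      forall n X Y : nat, (X, Y) = (1%N, n) \/ (X, Y) = (n, 1%N) ->
        star a b M1 M2 X Y ->
        [/\ exists v : verma lam,
              [/\ maximal_vector v, weight_space (lam - wt X Y) v
                & forall w : verma lam, maximal_vector w ->
                    weight_space (lam - wt X Y) w ->
                    exists c : R[i], w = c *: v],
            has_dim (maximal_space (V := verma lam) (lam - wt X Y)) 1,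
            hom_has_dim (verma (lam - wt X Y)) (verma lam) 1
          & has_dim (root_space (wt X Y)) 1]
    & (* (c) *)
      star a b M1 M2 2 2 ->
        [/\ exists v : 'I_2 -> verma lam,
              lin_indep v /\ forall i, maximal_space (lam - wt 2%N 2%N) (v i),
            has_dim (maximal_space (V := verma lam) (lam - wt 2%N 2%N)) 2,
            hom_has_dim (verma (lam - wt 2%N 2%N)) (verma lam) 2
          & exists d1 d2 : nat,
              [/\ has_dim (root_space (wt 1%N 1%N)) d1,
                  has_dim (root_space (wt 2%N 2%N)) d2
                & (d1 + d2)%N = 2%N]]].
Proof.
move=> wt.
have sf := bkm_matrix_serre_free R ha hb.
have [M1gt0 lam0] := Ppm_coroot hb hlam hM1.
have [M2gt0 lam1] := Ppm_coroot hb hlam hM2.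
have b0 : b%:R != 0 :> R[i] by rewrite pnatr_eq0 -lt0n.
have wt1n n : word_wt H (0 :: nseq n 1) = wt 1%N n.
  by rewrite word_wt_cons /word_wt big_nseq iter_addr addr0.
have wtn1 n : word_wt H (1 :: nseq n 0) = wt n 1%N.
  by rewrite word_wt_cons /word_wt big_nseq iter_addr addr0 addrC.
have wt22 : word_wt H [:: 0; 0; 1; 1] = wt 2%N 2%N.
  by rewrite !word_wt_cons /word_wt big_nil addr0 /wt !mulr2n !addrA.
split.
- move=> n nE _ v vlam w w0; split=> //.
    eexists; exact: (iter_f_weight 1 n (iter_f_weight 0 M1 vlam)).
  apply: (maximal_iter_f (iter_f_weight 0 M1 vlam)).
    apply: (maximal_iter_f vlam (weight_space_killed sf vlam)).
    (* By the definition of [M1], [2 lam(h_1) = - b (M1 - 1)]. *)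
    rewrite lam0 bkm_matrix_diag -[in RHS](prednK M1gt0) -natr1.
    by field.
  (* On weight [lam - M1 alpha_1], twice the value at the second coroot is [- b (M2 - 1) + 2 a M1],
     which the value of [n] turns into [- b (n - 1)]. *)
  rewrite add_lfunE opp_lfunE mulrn_lfunE simple_root_coroot lam1.
  rewrite bkm_matrix_diag bkm_matrix_off //.
  have nE' : (b * n + 2 * a * M1 = b * M2)%N.
    have b0' : b%:R != 0 :> rat by rewrite pnatr_eq0 -lt0n.
    apply/eqP; rewrite -(eqr_nat rat) !(natrD, natrM) nE; apply/eqP.
    by field.
  move/(congr1 (fun z => z%:R : R[i])): nE'.
  rewrite -{1}(prednK M2gt0) !(natrD, natrM) -natr1 => E.
  have bM : b%:R * (M2.-1)%:R = b%:R * n%:R + 2 * a%:R * M1%:R - b%:R :> R[i].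
    by rewrite E; ring.
  rewrite -mulr_natl.
  transitivity (- (b%:R * (M2.-1)%:R) + 2 * M1%:R * a%:R :> R[i]);
    first by field.
  by rewrite bM; ring.
- move=> n X Y XY /(star_nat hb) starE.
  have dimM : has_dim (maximal_space (V := verma lam) (lam - wt X Y)) 1.
    case: XY starE => -[-> ->] starE.
      by rewrite -wt1n; apply: (verma_dim_1n ha hb) lam0 lam1 _ => //; nia.
    (* For [(n, 1)] the two letters exchange roles: [p = 1] and [q = 0]. *)
    by rewrite -wtn1; apply: (verma_dim_1n ha hb) lam1 lam0 _ => //; nia.
  split=> //; last 1 first.
  + case: XY => -[-> ->]; rewrite -?wt1n -?wtn1; exact: root_space_1n.
  + have [v [[vw vk] v0 vU]] := has_dim1_ex dimM.
    exists v; split=> // [|w [_ _ wk] ww]; last exact: vU.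
    by split=> //; exists (lam - wt X Y).
  + exact: hom_has_dim_maximal.
- move=> /(star_nat hb) starE.
  have dimM : has_dim (maximal_space (V := verma lam) (lam - wt 2%N 2%N)) 2.
    by rewrite -wt22; exact: (verma_dim_22 ha hb _ _ lam0 lam1).
  split=> //.
  + by have [v [vP vI _]] := dimM; exists v.
  + exact: hom_has_dim_maximal.
  + exists 1%N, 1%N; split=> //; rewrite -?wt22 -?wt1n.
      exact: (root_space_1n _ sf _ 1).
    exact: root_space_22.
Qed.
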